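(* Let $P$ be a $d$-dimensional reflexive polytope in $M_{\mathbb{R}}$, with set of roots $\mathcal{R}$ and set of semisimple roots $\mathcal{S}=\mathcal{R}\cap(-\mathcal{R})$. Let $B\subseteq\mathcal{S}$ be an $A$-root basis for a subset $A\subseteq\mathcal{R}$, and let $C_1,\dots,C_t$ be the partition of $B$ into equivalence classes (with respect to $\equiv$), of orders $c_1,\dots,c_t$. Then there are isomorphisms of lattice polytopes (with respect to the lattices $\mathrm{lin}(A)\cap M$ and $\mathbb{Z}^{c_1+\cdots+c_t}$) $$P\cap\mathrm{lin}(A)\;\cong\;\bigoplus_{i=1}^t P\cap\mathrm{lin}(C_i)\;\cong\;\bigoplus_{i=1}^t E^*_{c_i}.$$ In particular, the intersection of $P$ with the space spanned by all semisimple roots is again a reflexive polytope corresponding to a product of projective spaces.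
   Context: $N\cong\mathbb{Z}^d$ is a lattice with dual lattice $M$ and pairing $\langle\cdot,\cdot\rangle$. For a rational $d$-dimensional polytope $P\subseteq M_{\mathbb{R}}$ with $0\in\mathrm{int}\,P$, $P^*=\{y\in N_{\mathbb{R}}:\langle x,y\rangle\ge-1\ \forall x\in P\}$ is the dual polytope; $P$ is reflexive if $P$ and $P^*$ are lattice polytopes. The toric variety corresponding to $P$ is the one defined by the normal fan of $P$, i.e., the fan of cones $\mathrm{pos}(F)$ over faces $F$ of $P^*$. The set of roots $\mathcal{R}$ of a reflexive polytope $P$ is the set of lattice points in the relative interiors of facets of $P$. For $m\in\mathcal{R}$, $\eta_m\in N$ is the primitive inner normal of the unique facet containing $m$, normalized to take the value $-1$ on this facet. $\mathrm{lin}$ denotes the real linear hull. Two roots $v,w$ are orthogonal if $\langle\eta_v,w\rangle=0=\langle\eta_w,v\rangle$. For $A\subseteq\mathcal{R}$, an $A$-root basis is a pairwise orthogonal family $B\subseteq A$ with $A=\mathcal{R}\cap\mathrm{lin}(B)$. For $v,w\in\mathcal{S}$, $v$ and $w$ are equivalent, $v\equiv w$, if $\eta_{-v}=\eta_{-w}$. $E_k$ is the $k$-dimensional simplex $\mathrm{conv}(e_1,\dots,e_k,-e_1-\cdots-e_k)$, where $e_1,\dots,e_k$ is a $\mathbb{Z}$-basis of the lattice $\mathbb{Z}^k$, and $E_k^*$ is its dual polytope (in the dual lattice, also identified with $\mathbb{Z}^k$), so that the normal fan of $E_k^*$ defines $\mathbb{P}^k$. The symbol $\bigoplus$ denotes the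 product of polytopes, taken in the direct sum of the corresponding vector spaces, each $P\cap\mathrm{lin}(C_i)$ being considered with respect to the lattice $\mathrm{lin}(C_i)\cap M$. An isomorphism of lattice polytopes is an isomorphism of the associated lattices whose induced real linear map sends one polytope onto the other. *)

(* Defs.v *)
From mathcomp Require Import all_boot all_order all_algebra.
From mathcomp Require Import all_classical all_reals all_analysis.

Set Implicit Arguments.
Unset Strict Implicit.
Unset Printing Implicit Defensive.

Import Order.TTheory GRing.Theory Num.Theory.
Import numFieldNormedType.Exports.

Local Open Scope classical_set_scope.
Local Open Scope ring_scope.

(* A lattice M with M_R = V is represented by the subset M of V; the dual     *)
(* lattice N then lives in N_R = 'Hom(V, R^o), and the pairing <x, y> is y x. *)

Definition is_lattice (R : realType) (V : vectType R) (M : set V) : Prop :=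
  exists2 b : (\dim {:V}).-tuple V, basis_of {:V} b &
    M = [set x | exists z : 'I_(\dim {:V}) -> int,
                   x = \sum_i (z i)%:~R *: b`_i].

Definition dual_lattice (R : realType) (V : vectType R) (M : set V) :
    set 'Hom(V, R^o) :=
  [set y | forall m, M m -> (y m : R) \is a Num.int].

Definition int_lattice (R : realType) (n : nat) : set 'rV[R]_n :=
  [set x | forall i, x 0 i \is a Num.int].

(* The linear hull is the smallest subspace containing A; it always exists    *)
(* (V is finite-dimensional), so the default value 0 is never used.           *)
Definition lin (R : realType) (V : vectType R) (A : set V) : {vspace V} :=
  xget 0%VS [set U : {vspace V} |
    (forall x, A x -> x \in U) /\
    (forall W : {vspace V}, (forall x, A x -> x \in W) -> (U <= W)%VS)].

Definition conv_hull (R : realType) (V : vectType R) (A : set V) : set V :=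
  [set x | exists n (v : 'I_n -> V) (a : 'I_n -> R),
    [/\ forall i, A (v i), forall i, 0 <= a i,
        \sum_i a i = 1 & x = \sum_i a i *: v i]].

Definition pos_hull (R : realType) (V : vectType R) (A : set V) : set V :=
  [set x | exists n (v : 'I_n -> V) (a : 'I_n -> R),
    [/\ forall i, A (v i), forall i, 0 <= a i & x = \sum_i a i *: v i]].

Definition direction (R : realType) (V : vectType R) (A : set V) : {vspace V} :=
  lin [set z | exists x y, [/\ A x, A y & z = x - y]].

Definition affine_hull (R : realType) (V : vectType R) (A : set V) : set V :=
  [set x | exists2 y, A y & x - y \in direction A].

(* A vectType carries no topology in the library: neighbourhoods are taken in *)
(* the coordinates of a basis.                                                *)
Definition near_vect (R : realType) (V : vectType R) (x : V) (A : set V) : Prop :=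
  \forall z \near passmx.rVof (vbasis {:V}) x, A (passmx.vecof (vbasis {:V}) z).

Definition vect_interior (R : realType) (V : vectType R) (A : set V) : set V :=
  [set x | near_vect x A].

Definition relint (R : realType) (V : vectType R) (A : set V) : set V :=
  [set x | A x /\ near_vect x [set y | affine_hull A y -> A y]].

(* Both P itself and the empty set are faces of P. *)
Definition face (R : realType) (V : vectType R) (P F : set V) : Prop :=
  exists (u : 'Hom(V, R^o)) (c : R),
    (forall x, P x -> c <= (u x : R)) /\ F = P `&` [set x | u x = c].

Definition facet (R : realType) (V : vectType R) (P F : set V) : Prop :=
  [/\ face P F, F !=set0 & (\dim (direction F)).+1 = \dim (direction P)].

Definition lattice_polytope (R : realType) (V : vectType R) (M P : set V) : Prop :=
  exists2 s : seq V, (forall x, x \in s -> M x) & P = conv_hull [set` s].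

Definition dual_polytope (R : realType) (V : vectType R) (P : set V) :
    set 'Hom(V, R^o) :=
  [set y | forall x, P x -> -1 <= (y x : R)].

(* P is of full dimension \dim V because 0 is an interior point. *)
Definition reflexive_polytope (R : realType) (V : vectType R) (M P : set V) : Prop :=
  [/\ is_lattice M, vect_interior P 0, lattice_polytope M P &
      lattice_polytope (dual_lattice M) (dual_polytope P)].

Definition root_set (R : realType) (V : vectType R) (M P : set V) : set V :=
  [set m | M m /\ exists2 F, facet P F & relint F m].

Definition semisimple_roots (R : realType) (V : vectType R) (M P : set V) : set V :=
  root_set M P `&` [set m | root_set M P (- m)].

Definition primitive_vect (R : realType) (V : vectType R) (L : set V) (y : V) : Prop :=
  L y /\ forall (k : nat) z, L z -> y = z *+ k -> k = 1%N.

(* For a root m of a reflexive polytope the set below is a singleton. *)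
Definition eta (R : realType) (V : vectType R) (M P : set V) (m : V) :
    'Hom(V, R^o) :=
  xget 0 [set y | primitive_vect (dual_lattice M) y /\
    exists F, [/\ facet P F, F m, forall x, P x -> -1 <= (y x : R) &
                  F = P `&` [set x | (y x : R) = -1]]].

Definition orthogonal_roots (R : realType) (V : vectType R) (M P : set V)
    (v w : V) : Prop :=
  eta M P v w = 0 /\ eta M P w v = 0.

Definition root_basis (R : realType) (V : vectType R) (M P A B : set V) : Prop :=
  [/\ A `<=` root_set M P, B `<=` A,
      forall v w, B v -> B w -> v <> w -> orthogonal_roots M P v w &
      A = root_set M P `&` [set` lin B]].

Definition equiv_roots (R : realType) (V : vectType R) (M P : set V)
    (v w : V) : Prop :=
  eta M P (- v) = eta M P (- w).

Definition equiv_classes (R : realType) (V : vectType R) (M P B : set V) :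
    set (set V) :=
  [set [set w | B w /\ equiv_roots M P v w] | v in B].

(* L1 and L2 may have smaller rank than their ambient spaces.  A linear map   *)
(* of the ambient spaces restricting to a bijection L1 -> L2 is the same as   *)
(* (an arbitrary linear extension of) the real linear map induced by a        *)
(* lattice isomorphism; only its values on the span of L1 matter.             *)
Definition lattice_polytope_iso (R : realType) (V1 V2 : vectType R)
    (L1 P1 : set V1) (L2 P2 : set V2) : Prop :=
  exists f : 'Hom(V1, V2), set_bij L1 L2 f /\ f @` P1 = P2.

Definition direct_sum (R : realType) (V : vectType R) (t : nat)
    (Q : 'I_t -> set V) : set {ffun 'I_t -> V} :=
  [set f | forall i, Q i (f i)].

(* Direct sums with distinct summands are taken in R^(c_1 + ... + c_t). *)
Definition direct_sum_rV (R : realType) (t : nat) (c : 'I_t -> nat)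
    (Q : forall i, set 'rV[R]_(c i)) : set 'rV[R]_(\sum_i c i) :=
  [set x | forall i, Q i (submxrow x i)].

Definition simplex (R : realType) (k : nat) : set 'rV[R]_k :=
  conv_hull (range (delta_mx 0) `|` [set - \sum_i delta_mx 0 i]).

(* The dual space of 'rV_k is identified with 'rV_k by the standard pairing. *)
Definition dual_simplex (R : realType) (k : nat) : set 'rV[R]_k :=
  [set y | forall x, @simplex R k x -> -1 <= \sum_i x 0 i * y 0 i].

Definition face_fan (R : realType) (V : vectType R) (Q : set V) : set (set V) :=
  [set pos_hull F | F in [set F | face Q F /\ F <> Q]].

Definition normal_fan (R : realType) (V : vectType R) (P : set V) :
    set (set 'Hom(V, R^o)) :=
  face_fan (dual_polytope P).

(* The fan of P^k: the normal fan of dual_simplex k, whose dual is simplex k. *)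
Definition projective_fan (R : realType) (k : nat) : set (set 'rV[R]_k) :=
  face_fan (@simplex R k).

(* The fan of P^(c_1) x ... x P^(c_t) is the product of the fans. *)
Definition projective_product_fan (R : realType) (t : nat) (c : 'I_t -> nat) :
    set (set 'rV[R]_(\sum_i c i)) :=
  [set s | exists2 tau : forall i, set 'rV[R]_(c i),
     forall i, projective_fan (tau i) & s = direct_sum_rV tau].

Definition fan_iso (R : realType) (V1 V2 : vectType R)
    (N1 : set V1) (S1 : set (set V1)) (N2 : set V2) (S2 : set (set V2)) : Prop :=
  exists f : 'Hom(V1, V2),
    set_bij N1 N2 f /\ [set f @` s | s in S1] = S2.

(* The toric variety of the normal fan of P with respect to the lattice dual  *)
(* to M is a product of projective spaces; isomorphism of toric varieties is  *)
(* expressed as isomorphism of their fans.                                    *)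
Definition product_of_projective_spaces (R : realType) (V : vectType R)
    (M P : set V) : Prop :=
  exists t (c : 'I_t -> nat),
    fan_iso (dual_lattice M) (normal_fan P)
            (@int_lattice R (\sum_i c i)) (@projective_product_fan R t c).

(* The part of A lying in the subspace U, as a subset of the vector space U. *)
Definition restrict_to (R : realType) (V : vectType R) (U : {vspace V}) (A : set V) :
    set (subvs_of U) :=
  [set u | A (vsval u)].
Arguments restrict_to {R V} U A.

(* Main.v *)
(* Write the dual polytope as the convex hull of a finite set Y of dual lattice *)
(* points, so that P is cut out by the inequalities y >= -1 for y in Y.  A root *)
(* m takes the value -1 on eta m, which lies in Y, and nonnegative integral     *)
(* values on the rest of Y; hence a semisimple root m satisfies                 *)
(* y m = [y = eta (- m)] - [y = eta m] for all y in Y.  For orthogonal roots b_s *)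
(* the functionals p_s = eta b_s are therefore, up to sign, dual to the b_s,    *)
(* and q_s = eta (- b_s) is minus the sum of the p_s' over the class of b_s,    *)
(* while every other y in Y vanishes on all b_s.  In the coordinates p_s the    *)
(* lattice is Z^n and P is the product, over the classes, of the simplices      *)
(* p_s >= -1, sum p_s <= 1.  The span of all semisimple roots has a basis of    *)
(* the same shape, whence its intersection with P is again such a product, and  *)
(* its fan is read off from the linear relations between the p_s and the q_s.   *)

From HB Require Import structures.
Require Import Defs.
From mathcomp Require Import all_boot all_order all_algebra.
From mathcomp Require Import all_classical all_reals all_analysis.
From mathcomp Require Import ring lra.

Set Implicit Arguments.
Unset Strict Implicit.
Unset Printing Implicit Defensive.

Import Order.TTheory GRing.Theory Num.Theory.
Import numFieldNormedType.Exports.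
Local Open Scope classical_set_scope.
Local Open Scope ring_scope.

(** Everything rests on [semisimple_root_values]: on the generators [Y] of the dual polytope a
    semisimple root is -1 once, 1 once and 0 otherwise. Convex duality makes this available:
    [bipolar] recovers [P] from [Y], and [facet_normal] shows that a facet has only one normal, so
    that [root_values] can identify [eta].

    Lattice vectors with such values, whose elements of value -1 are distinct and whose elements of
    value 1 are shared exactly within a block, are unimodular coordinates on their span
    ([lattice_coordinates]), and [P] becomes a product of dual simplices there
    ([polytope_coordinates]). For a root basis, orthogonality and the equivalence classes give these
    properties ([root_basis_iso]).

    For the span of all semisimple roots no orthogonal basis of roots is sought. Such a root is seen
    as an edge between two elements of [Y], and [semisimple_span_basis] joins the members of each
    class of connected elements to one representative. Reflexivity ([model_reflexive]) and the fan
    ([model_fan]) are then computed in coordinates, the latter by [face_fan_blocks]. *)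

(** * Linear, conic and convex hulls *)

Section Hulls.
Variables (R : realType) (V : vectType R).
Implicit Types (A : set V) (U : {vspace V}).

(** Among the subspaces containing [A], one of least dimension lies in every other: its intersection
    with [W] still contains [A], so the dimension cannot drop. *)
Lemma lin_spec A :
  (forall x, A x -> x \in lin A) /\
  (forall W : {vspace V}, (forall x, A x -> x \in W) -> (lin A <= W)%VS).
Proof.
rewrite /lin; case: xgetP => [U -> //|none].
suff [n] : exists n, exists U, [/\ (forall x, A x -> x \in U),
    \dim U = n & forall W : {vspace V}, (forall x, A x -> x \in W) -> (n <= \dim W)%N].
  case=> U [AU dU Umin]; exfalso; apply: (none U); split=> // W AW.
  have /Umin : forall x, A x -> x \in (U :&: W)%VS.
    by move=> x Ax; rewrite memv_cap AU ?AW.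
  rewrite -dU => dUW; have /eqP <- : (U :&: W == U)%VS.
    by rewrite eqEdim capvSl.
  exact: capvSr.
pose p n := `[< exists U : {vspace V}, (forall x, A x -> x \in U) /\ \dim U = n >].
have exp : exists n, p n.
  exists (\dim {:V}); apply/asboolP; exists fullv; split=> // x _; exact: memvf.
case: (ex_minnP exp) => n /asboolP [U [AU dU]] nmin.
exists n, U; split=> // W AW; apply: nmin; apply/asboolP; by exists W.
Qed.

Lemma mem_lin A x : A x -> x \in lin A.
Proof. by case: (lin_spec A) => + _; apply. Qed.

Lemma lin_sub A U : (forall x, A x -> x \in U) -> (lin A <= U)%VS.
Proof. by case: (lin_spec A) => _; apply. Qed.

Lemma linS A A' : A `<=` A' -> (lin A <= lin A')%VS.
Proof. by move=> AA'; apply: lin_sub => x /AA'; apply: mem_lin. Qed.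

Lemma lin_range (I : finType) (b : I -> V) :
  lin (range b) = (\sum_i <[b i]>)%VS.
Proof.
apply/eqP; rewrite eqEsubv; apply/andP; split.
  apply: lin_sub => _ [i _ <-].
  by apply: (subvP (sumv_sup i _ (subvv _))) => //; exact: memv_line.
by apply/subv_sumP => i _; rewrite -memvE; apply: mem_lin; exists i.
Qed.

Lemma mem_lin_range (I : finType) (b : I -> V) x :
  x \in lin (range b) -> exists a : I -> R, x = \sum_i a i *: b i.
Proof.
rewrite lin_range => /memv_sumP[v vb ->].
have H i : exists a, v i = a *: b i by apply/vlineP/vb.
by exists (fun i => sval (cid (H i))); apply: eq_bigr => i _; case: cid.
Qed.

(** Coefficients belonging to the same index are added up, so a point of a cone needs only one
    coefficient per index instead of an arbitrary finite list. *)
Lemma pos_hull_range (I : finType) (y : I -> V) (S : {set I}) x :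
  pos_hull (y @` [set` S]) x <->
  exists2 a : I -> R, forall i, 0 <= a i & x = \sum_(i in S) a i *: y i.
Proof.
split=> [[n [v [a [vS a0 ->]]]]|[a a0 ->]].
  have H j : exists i, i \in S /\ y i = v j by case: (vS j) => i iS <-; exists i.
  pose g j := sval (cid (H j)).
  have gS j : g j \in S by rewrite /g; case: cid => ? [].
  have gv j : y (g j) = v j by rewrite /g; case: cid => ? [].
  exists (fun i => \sum_(j | g j == i) a j); first by move=> i; apply: sumr_ge0.
  rewrite (partition_big g (mem S)) //=; apply: eq_bigr => i iS.
  rewrite scaler_suml; apply: eq_bigr => j /eqP <-; by rewrite gv.
exists #|S|, (fun j => y (enum_val j)), (fun j => a (enum_val j)); split=> //.
  by move=> j; exists (enum_val j) => //=; exact: enum_valP.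
by rewrite big_enum_val.
Qed.

Lemma conv_hull_range (I : finType) (y : I -> V) x :
  conv_hull (range y) x <->
  exists a : I -> R, [/\ forall i, 0 <= a i, \sum_i a i = 1 & x = \sum_i a i *: y i].
Proof.
split=> [[n [v [a [vS a0 a1 ->]]]]|[a [a0 a1 ->]]].
  have H j : exists i, y i = v j by case: (vS j) => i _ <-; exists i.
  pose g j := sval (cid (H j)).
  have gv j : y (g j) = v j by rewrite /g; case: cid.
  exists (fun i => \sum_(j | g j == i) a j); split.
  - by move=> i; apply: sumr_ge0.
  - by rewrite -a1 (partition_big g xpredT).
  rewrite (partition_big g xpredT) //=; apply: eq_bigr => i _.
  rewrite scaler_suml; apply: eq_bigr => j /eqP <-; by rewrite gv.
exists #|I|, (fun j => y (enum_val j)), (fun j => a (enum_val j)).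
split=> //; first by rewrite -a1 [RHS](reindex (@enum_val I xpredT)) //=; apply: onW_bij; apply: enum_val_bij.
rewrite (reindex (@enum_val I xpredT)) //=; apply: onW_bij; apply: enum_val_bij.
Qed.

Lemma set_seq_range (s : seq V) :
  [set` s] = range (fun i : 'I_(size s) => s`_i).
Proof.
apply/seteqP; split=> [x /= xs|_ [i _ <-] /=]; last by rewrite mem_nth.
by exists (Ordinal (eq_ind_r is_true xs (index_mem x s))) => //=; rewrite nth_index.
Qed.

Lemma sub_conv_hull A : A `<=` conv_hull A.
Proof.
move=> x Ax; exists 1%N, (fun=> x), (fun=> 1); split=> //.
- by rewrite big_ord1.
- by rewrite big_ord1 scale1r.
Qed.

Lemma conv_hull_ge A (u : 'Hom(V, R^o)) c :
  (forall x, A x -> c <= (u x : R)) -> forall x, conv_hull A x -> c <= (u x : R).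
Proof.
move=> Ac _ [n [v [a [Av a0 a1 ->]]]].
rewrite linear_sum /= -[c]mul1r -a1 mulr_suml; apply: ler_sum => i _.
by rewrite linearZ /=; apply: ler_wpM2l => //; exact: Ac.
Qed.

(** Complementary slackness: a weighted mean of numbers at least [c] equals [c] only if every number
    of nonzero weight does. *)
Lemma conv_hull_ge_eq (I : finType) (v : I -> V) (a : I -> R) (u : 'Hom(V, R^o)) c :
  (forall i, c <= (u (v i) : R)) -> (forall i, 0 <= a i) -> \sum_i a i = 1 ->
  (u (\sum_i a i *: v i) : R) = c ->
  forall i, a i = 0 \/ (u (v i) : R) = c.
Proof.
move=> vc a0 a1 uc i.
have s0 : \sum_i a i * ((u (v i) : R) - c) = 0.
  under eq_bigr do rewrite mulrBr.
  rewrite sumrB -mulr_suml a1 mul1r; apply/eqP; rewrite subr_eq0 -uc linear_sum /=.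
  by apply/eqP/eq_bigr => j _; rewrite linearZ.
have /psumr_eq0P : forall i, true -> 0 <= a i * ((u (v i) : R) - c).
  by move=> j _; rewrite mulr_ge0 ?subr_ge0.
move=> /(_ s0 i isT) /eqP; rewrite mulf_eq0 subr_eq0 => /orP[/eqP|/eqP]; by [left|right].
Qed.

Lemma pos_hullS A A' : A `<=` A' -> pos_hull A `<=` pos_hull A'.
Proof. by move=> AA' x [n [v [a [Av a0 ->]]]]; exists n, v, a; split=> // i; exact: AA'. Qed.

Lemma pos_hull_sub_cone (I : finType) (y : I -> V) (S : {set I}) A :
  A `<=` pos_hull (y @` [set` S]) -> pos_hull A `<=` pos_hull (y @` [set` S]).
Proof.
move=> AS x [n [v [a [Av a0 ->]]]].
have H j : exists b : I -> R, (forall i, 0 <= b i) /\ v j = \sum_(i in S) b i *: y i.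
  by have /pos_hull_range[b b0 vb] := AS _ (Av j); exists b.
pose b j := sval (cid (H j)).
have bP j : (forall i, 0 <= b j i) /\ v j = \sum_(i in S) b j i *: y i.
  by rewrite /b; case: cid.
apply/pos_hull_range; exists (fun i => \sum_j a j * b j i).
  by move=> i; apply: sumr_ge0 => j _; rewrite mulr_ge0 //; case: (bP j).
under eq_bigr do rewrite (proj2 (bP _)) scaler_sumr.
rewrite exchange_big; apply: eq_bigr => i _; rewrite scaler_suml.
by apply: eq_bigr => j _; rewrite scalerA.
Qed.

End Hulls.

(** * Farkas' lemma, separation and the bidual *)

Section Separation.
Variable R : realType.
Implicit Type V : vectType R.

Lemma linfunE V (W : vectType R) (f : V -> W) : linear f -> linfun f =1 f.
Proof.
move=> lf; pose g := HB.pack_for {linear V -> W} f (GRing.isLinear.Build _ _ _ _ f lf).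
by move=> x; rewrite (_ : f = g) // lfunE.
Qed.

Lemma dual_separates V (x : V) :
  (forall u : 'Hom(V, R^o), (u x : R) = 0) -> x = 0.
Proof.
move=> ux; rewrite (coord_vbasis (memvf x)) big1 // => i _.
have := ux (linfun (coord (vbasis {:V}) i : V -> R^o)).
by rewrite lfunE /= => ->; rewrite scale0r.
Qed.

(** Induction on the number of generators. If the functional [u] obtained without the first
    generator [a0] is negative on [a0], everything is projected along [a0] to the kernel of [u], and
    the induction hypothesis is applied to the images. *)
Lemma farkas V n (y : 'I_n -> V) x :
  (exists2 a : 'I_n -> R, forall i, 0 <= a i & x = \sum_i a i *: y i) \/
  exists u : 'Hom(V, R^o), (forall i, 0 <= (u (y i) : R)) /\ (u x : R) < 0.
Proof.
elim: n y x => [|n IH] y x.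
  have [->|x0] := eqVneq x 0.
    by left; exists (fun=> 0) => //; rewrite big_ord0.
  right; have [u ux] : exists u : 'Hom(V, R^o), (u x : R) != 0.
    apply: contrapT => none; move/eqP: x0; apply; apply: dual_separates => u.
    by apply/eqP; apply: contrapT => ux; apply: none; exists u; apply/negP.
  (* This multiple takes minus a nonzero square as its value at [x], whatever the sign of [u x]. *)
  exists (- (u x : R) *: u); split; first by case.
  rewrite scale_lfunE /= /GRing.scale /=.
  by rewrite mulNr oppr_lt0 lt_def mulf_eq0 orbb ux -expr2 sqr_ge0.
have [[a a0 ax]|[u [uy ux]]] := IH (y \o lift ord0) x.
  left; exists (fun i => if unlift ord0 i is Some j then a j else 0).
    by move=> i; case: unlift.
  rewrite big_ord_recl unlift_none scale0r add0r ax; apply: eq_bigr => i _.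
  by rewrite liftK.
have [ua|ua] := lerP 0 (u (y ord0) : R).
  right; exists u; split=> // i; case: (unliftP ord0 i) => [j ->|->] //; exact: uy.
set a0 := y ord0 in ua *.
pose h (z : V) := z - ((u z : R) / (u a0 : R)) *: a0.
(* [h] projects onto the kernel of [u] along [a0]. *)
have hl : linear h.
  move=> k v w; rewrite /h linearP /= mulrDl scalerDl opprD.
  rewrite scalerBr scalerA addrACA; congr (_ - _ *: _ + _).
  by rewrite mulrA.
have [[a ap ax]|[w [wy wx]]] := IH (h \o (y \o lift ord0)) (h x).
  (* The corrections made by [h] collect into the coefficient of [a0]; it is nonnegative because [u]
     is negative at [x] and [a0] and nonnegative at the other generators. *)
  left; exists (fun i => if unlift ord0 i is Some j then a j else
      (u x : R) / (u a0 : R) + \sum_j a j * - ((u (y (lift ord0 j)) : R) / (u a0 : R))).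
    move=> i; case: unlift => // ; apply: addr_ge0.
      by rewrite mulr_le0 ?invr_le0 ?ltW.
    apply: sumr_ge0 => j _; apply: mulr_ge0 => //.
    by rewrite oppr_ge0 mulr_ge0_le0 // ?uy // invr_le0 ltW.
  rewrite big_ord_recl unlift_none.
  rewrite [LHS](_ : x = h x + ((u x : R) / (u a0 : R)) *: a0); last by rewrite /h subrK.
  rewrite ax addrC -/a0 scalerDl -addrA; congr (_ + _).
  rewrite scaler_suml -big_split; apply: eq_bigr => j _ /=.
  by rewrite liftK /h scalerBr scalerA mulrN scaleNr addrC.
right; exists (w \o linfun h)%VF; split => [i|].
  rewrite comp_lfunE linfunE //; case: (unliftP ord0 i) => [j ->|->]; first exact: wy.
  by rewrite -/a0 /h divff ?lt_eqF // scale1r subrr linear0.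
by rewrite comp_lfunE linfunE.
Qed.

(** Homogenization: [x] lies in the hull exactly if [(x, 1)] lies in the cone over the points
    [(v, 1)]. The last component of the Farkas functional becomes, up to sign, the constant [c]. *)
Lemma separation V (s : seq V) x : ~ conv_hull [set` s] x ->
  exists (u : 'Hom(V, R^o)) c,
    (u x : R) < c /\ forall z, conv_hull [set` s] z -> c <= (u z : R).
Proof.
rewrite set_seq_range => xs.
pose W := (V * R^o)%type : vectType R.
have [[a a0 ax]|[w [wy wx]]] :=
  farkas (fun i : 'I_(size s) => (s`_i, 1 : R^o) : W) ((x, 1) : W).
  exfalso; apply: xs; apply/conv_hull_range; exists a; split=> //.
    have /(congr1 snd) /= := ax; rewrite raddf_sum /= => ->.
    by apply: eq_bigr => i _; rewrite /GRing.scale /= mulr1.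
  by have /(congr1 fst) /= := ax; rewrite raddf_sum.
have lu : linear (fun v : V => w ((v, 0) : W) : R^o).
  by move=> k v v'; rewrite -linearP; congr (w (_, _)); rewrite /= scaler0 addr0.
have wE v : (w ((v, 1) : W) : R) = (linfun (fun v : V => w ((v, 0) : W) : R^o) v : R) + w ((0, 1) : W).
  rewrite [linfun _ v]linfunE //; apply: etrans (linearD w ((v, 0) : W) ((0, 1) : W)).
  by congr (w (_, _)); rewrite /= ?addr0 ?add0r.
exists (linfun (fun v : V => w ((v, 0) : W) : R^o)), (- w ((0, 1) : W)); split.
  by rewrite -subr_lt0 opprK -wE.
apply: conv_hull_ge => _ [i _ <-].
by rewrite -subr_ge0 opprK -wE wy.
Qed.

(** Lets a functional that separates points of the dual space be read as a point of [V]. *)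
Lemma dual_eval V (w : 'Hom('Hom(V, R^o), R^o)) :
  exists x : V, forall u : 'Hom(V, R^o), (w u : R) = u x.
Proof.
pose e := vbasis {:V}.
pose f i := linfun (coord e i : V -> R^o).
exists (\sum_(i < \dim {:V}) (w (f i) : R) *: e`_i) => u.
have -> : u = \sum_(i < \dim {:V}) (u (e`_i) : R) *: f i.
  apply/lfunP => x; rewrite {1}(coord_vbasis (memvf x)) linear_sum sum_lfunE.
  apply: eq_bigr => i _; rewrite linearZ scale_lfunE lfunE /=.
  by rewrite /GRing.scale /= mulrC.
rewrite linear_sum /= linear_sum /=; apply: eq_bigr => i _.
rewrite linearZ /= linearZ /= sum_lfunE (bigD1 i) //= big1 ?addr0.
  rewrite scale_lfunE lfunE /= coord_free ?eqxx; last exact/basis_free/vbasisP.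
  by rewrite /GRing.scale /= mulr1 mulrC.
move=> j ji; rewrite scale_lfunE lfunE /= coord_free.
  case: eqP => [E|]; last by rewrite scaler0.
  by case/eqP: ji; apply: val_inj; rewrite /= E.
exact/basis_free/vbasisP.
Qed.

End Separation.

(** * Interior points, lines and inequalities *)

Section NearVect.
Variables (R : realType) (V : vectType R).
Implicit Types A : set V.

Lemma near_vect_in A x : near_vect x A -> A x.
Proof.
move=> /nbhs_singleton; rewrite passmx.rVofK //; exact/vbasisP.
Qed.

Lemma near_vect_line A x z : near_vect x A -> exists2 e : R, 0 < e & A (x + e *: z).
Proof.
move=> /nbhs_ballP [e /= e0 eA].
pose k := 1 + \sum_i `|passmx.rVof (vbasis {:V}) z 0 i|.
have k0 : 0 < k by rewrite ltr_pwDl // sumr_ge0.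
exists (e / k); first exact: divr_gt0.
rewrite -[x + _](passmx.rVofK (vbasisP _)); apply: eA.
split=> // i j; rewrite /ball /= !mxE linearD linearZ /= opprD addNKr normrN.
rewrite normrM gtr0_norm ?divr_gt0 // mulrAC ltr_pdivrMr //.
rewrite ltr_pM2l // /k (bigD1 j) //= mxE ltr_pwDl // lerDl sumr_ge0 //.
Qed.

Lemma near_vect_ge (s : seq 'Hom(V, R^o)) (c : R) x :
  (forall y, y \in s -> c < (y x : R)) ->
  near_vect x [set z | forall y, y \in s -> c <= (y z : R)].
Proof.
rewrite /near_vect; elim: s => [|y s IH] sx; first by near=> z => /=.
have yx : c < (y x : R) by apply: sx; rewrite mem_head.
have /IH {}IH : forall y, y \in s -> c < (y x : R).
  by move=> y' ys; apply: sx; rewrite in_cons ys orbT.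
have : \forall z \near passmx.rVof (vbasis {:V}) x,
    c <= (y (passmx.vecof (vbasis {:V}) z) : R).
  (* [k - 1] is a Lipschitz constant of [y] for the maximum norm on coordinates; the 1 keeps the
     radius below meaningful for [y = 0]. *)
  pose k := 1 + \sum_(i < \dim {:V}) `|(y (vbasis {:V})`_i : R)|.
  have k0 : 0 < k by rewrite ltr_pwDl // sumr_ge0.
  apply/nbhs_ballP; exists (((y x : R) - c) / k); first by rewrite /= divr_gt0 ?subr_gt0.
  move=> z [_ xz]; rewrite -subr_ge0.
  have -> : (y (passmx.vecof (vbasis {:V}) z) : R) - c =
      ((y x : R) - c) - \sum_i (passmx.rVof (vbasis {:V}) x 0 i - z 0 i) * (y (vbasis {:V})`_i : R).
    have yE t : (y (passmx.vecof (vbasis {:V}) t) : R) =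
        \sum_i t 0 i * (y (vbasis {:V})`_i : R).
      by rewrite linear_sum; apply: eq_bigr => i _; rewrite linearZ.
    under eq_bigr do rewrite mulrBl; rewrite sumrB -!yE passmx.rVofK ?vbasisP //.
    by rewrite opprB [RHS]addrC addrA subrK.
  rewrite subr_ge0; apply: (@le_trans _ _ (((y x : R) - c) / k * (k - 1))).
    rewrite {2}/k addrAC subrr add0r mulr_sumr; apply: ler_sum => i _.
    apply: (le_trans (ler_norm _)); rewrite normrM ler_wpM2r //.
    by apply/ltW; have := xz 0 i; rewrite /ball /=.
  rewrite mulrAC ler_pdivrMr // ler_wpM2l ?subr_ge0 ?ltW // gtrBl ltr01 //.
move=> ?; near=> z => y'; rewrite in_cons => /orP[/eqP ->|].
  by near: z.
move: y'; near: z; exact: IH.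
Unshelve. all: by end_near. Qed.

End NearVect.

(** * Facet normals and the values of roots *)

Section Roots.
Variables (R : realType) (V : vectType R).
Implicit Types (M P F : set V) (Y : seq 'Hom(V, R^o)).

(** A point outside [P] is separated by a functional which, suitably scaled, lies in the dual
    polytope but is below -1 at that point; a convex combination of elements of [Y] cannot be, where
    all of [Y] is at least -1. *)
Lemma bipolar P (s : seq V) Y :
  P = conv_hull [set` s] -> dual_polytope P = conv_hull [set` Y] -> P 0 ->
  P = [set x | forall y, y \in Y -> -1 <= (y x : R)].
Proof.
move=> Ps PY P0; apply/seteqP; split=> [x Px y yY|x /= xY] /=.
  have : dual_polytope P y by rewrite PY; exact: sub_conv_hull.
  exact.
rewrite Ps; apply: contrapT => /separation[u [c [ux uc]]].
have c0 : c <= 0 by rewrite -(linear0 u) uc // -Ps.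
(* The midpoint of [- c] and [- u x], positive even if [c = 0]; divided by it, [u] is at least -1 on
   [P] and below -1 at [x]. *)
pose k := - (c + (u x : R)) / 2.
have k0 : 0 < k by rewrite /k; lra.
have : dual_polytope P (k^-1 *: u).
  move=> z; rewrite Ps => /uc uz; rewrite scale_lfunE /GRing.scale /=.
  by rewrite mulrC ler_pdivlMr // mulN1r /k; lra.
rewrite PY => -[n [v [a [vY a0 a1 kE]]]].
have : -1 <= (k^-1 *: u) x :> R.
  rewrite kE sum_lfunE -[-1]mul1r -{1}a1 mulr_suml; apply: ler_sum => i _.
  rewrite scale_lfunE /GRing.scale /= ler_wpM2l //; apply: xY; exact: vY.
apply/negP; rewrite -ltNge scale_lfunE /GRing.scale /=.
by rewrite mulrC ltr_pdivrMr // mulN1r /k; lra.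
Qed.

Lemma direction_full P : near_vect 0 P -> direction P = fullv.
Proof.
move=> P0; apply/eqP; rewrite eqEsubv subvf; apply/subvP => z _.
have [e e0] := near_vect_line z P0; rewrite add0r => Pz.
rewrite -(scalerK (lt0r_neq0 e0) z) memvZ // mem_lin //.
by exists (e *: z), 0; rewrite subr0; split=> //; exact: near_vect_in.
Qed.

(** From [x] one can go through [m] and slightly beyond within [F]; if [y x] were above the minimum,
    [y] would drop below it there. *)
Lemma relint_min F m (y : 'Hom(V, R^o)) c :
  relint F m -> (forall x, F x -> c <= (y x : R)) -> (y m : R) = c ->
  forall x, F x -> (y x : R) = c.
Proof.
move=> [Fm mF] yc ym x Fx; apply/le_anti; rewrite yc // andbT.
have [e e0 /= Fe] := near_vect_line (m - x) mF.
have : F (m + e *: (m - x)).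
  apply: Fe; exists m => //; rewrite addrC addKr memvZ // mem_lin //.
  by exists m, x.
move/yc; rewrite linearD linearZ linearB /= ym lerDl /GRing.scale /=.
by rewrite pmulr_rge0 // subr_ge0.
Qed.

(** The level [c] is not 0, since a functional nonnegative around the origin vanishes and the face
    would be all of [P]. By dimension the direction of the facet is the whole kernel of [u], so a
    functional constant on [F] is determined by its value there. *)
Lemma facet_normal P F (u : 'Hom(V, R^o)) c m : near_vect 0 P -> facet P F ->
  (forall x, P x -> c <= (u x : R)) -> F = P `&` [set x | (u x : R) = c] -> F m ->
  c < 0 /\ forall y : 'Hom(V, R^o),
    (forall x, F x -> (y x : R) = -1) -> y = - c^-1 *: u.
Proof.
move=> P0 [_ _ dF] uc FE Fm; have um : (u m : R) = c by move: Fm; rewrite FE => -[].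
have c0 : c < 0.
  have : c <= 0 by rewrite -(linear0 u) uc //; exact: near_vect_in.
  rewrite le_eqVlt => /predU1P[c0|//].
  suff u0 z : (u z : R) = 0.
    have FP : F = P by rewrite FE; apply/seteqP; split=> [x []|x Px] //; split=> //=; rewrite u0.
    by move: dF; rewrite FP => /eqP; rewrite eqn_leq ltnn.
  have ge0 t : 0 <= (u t : R).
    have [e e0] := near_vect_line t P0; rewrite add0r => /uc.
    by rewrite linearZ /= c0 /GRing.scale /= pmulr_rge0.
  by apply/le_anti; rewrite ge0 andbT -oppr_ge0 -linearN ge0.
split=> // y yF.
have FkerI (w : 'Hom(V, R^o)) k : (forall x, F x -> (w x : R) = k) -> (direction F <= lker w)%VS.
  move=> wF; apply: lin_sub => _ [a [b [Fa Fb ->]]].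
  by rewrite memv_ker linearB /= (wF _ Fa) (wF _ Fb) subrr.
have uker : direction F = lker u.
  apply/eqP; rewrite eqEdim (FkerI u c) => [|x]; last by rewrite FE => -[].
  rewrite -ltnS dF direction_full // ltnNge; apply/negP => dker.
  have /eqP kerT : lker u == fullv by rewrite eqEdim subvf.
  have : m \in lker u by rewrite kerT memvf.
  by rewrite memv_ker um lt_eqF.
apply/lfunP => x; rewrite scale_lfunE.
have : x - ((u x : R) / c) *: m \in lker y.
  apply: (subvP (FkerI y (-1) yF)); rewrite uker memv_ker linearB linearZ /= um.
  by rewrite /GRing.scale /= divfK ?(lt_eqF c0) // subrr.
rewrite memv_ker linearB linearZ /= (yF _ Fm) subr_eq0 => /eqP ->.
by rewrite /GRing.scale /= mulrN1 mulNr mulrC.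
Qed.

Section Reflexive.
Variables (M P : set V) (Y : seq 'Hom(V, R^o)).
Hypothesis P0 : near_vect 0 P.
Hypothesis PE : P = [set x | forall y, y \in Y -> -1 <= (y x : R)].
Hypothesis YE : dual_polytope P = conv_hull [set` Y].
Hypothesis Yint : forall y, y \in Y -> dual_lattice M y.

(** Some element of [Y] is -1 at [m], since [m] is not interior to [P]; only one is, since it is
    then -1 on the whole facet. Integrality lifts the other values from above -1 to at least 0. *)
Lemma root_values m : root_set M P m ->
  [/\ eta M P m \in Y, (eta M P m m : R) = -1 &
      forall y, y \in Y -> y != eta M P m -> 0 <= (y m : R)].
Proof.
move=> [Mm [F fF rF]]; have Fm : F m by case: rF.
have [[u [c [uc FE]]] _ _] := fF.
have [c0 norm] := facet_normal P0 fF uc FE Fm.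
have um : (u m : R) = c by move: Fm; rewrite FE => -[].
have FP x : F x -> P x by rewrite FE => -[].
have Yge y x : y \in Y -> P x -> -1 <= (y x : R) by move=> yY; rewrite PE; apply.
have uniqY y : y \in Y -> (y m : R) = -1 -> y = - c^-1 *: u.
  move=> yY ym; apply: norm; apply: (relint_min rF) => // x Fx.
  by apply: Yge => //; apply: FP.
have [y0 y0Y y0m] : exists2 y, y \in Y & (y m : R) = -1.
  apply: contrapT => none.
  have : near_vect m P.
    rewrite PE; apply: near_vect_ge => y yY; rewrite lt_def Yge ?andbT //; last exact: FP.
    by apply/eqP => ym; apply: none; exists y.
  move=> /(near_vect_line m)[e e0 /uc]; rewrite linearD linearZ /= um lerDl.
  by rewrite /GRing.scale /= pmulr_rge0 // leNgt c0.
have FE' : F = P `&` [set x | (y0 x : R) = -1].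
  rewrite (uniqY _ y0Y y0m) FE; apply/seteqP; split=> x [Px /= ux]; split=> //=.
    by rewrite scale_lfunE ux /GRing.scale /= mulNr mulVf ?(lt_eqF c0).
  move: ux; rewrite scale_lfunE /GRing.scale /= mulNr => /oppr_inj.
  by move/(congr1 ( *%R c)); rewrite mulrA mulfV ?(lt_eqF c0) // mul1r mulr1.
(* Uniqueness in the whole dual polytope: the functional chosen by [eta] is not known in advance to
   belong to [Y]. *)
have Ym (y : 'Hom(V, R^o)) : (forall x, P x -> -1 <= (y x : R)) -> (y m : R) = -1 -> y = y0.
  move=> yP ym; have : dual_polytope P y by [].
  rewrite YE => -[n [v [a [vY a0 a1 yE]]]].
  have Vge i : -1 <= (v i m : R) by apply: Yge (FP _ Fm); apply: vY.
  have : \sum_i a i * ((v i m : R) + 1) = 0.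
    under eq_bigr do rewrite mulrDr mulr1; rewrite big_split /= a1.
    have -> : \sum_i a i * (v i m : R) = y m.
      by rewrite yE sum_lfunE; apply: eq_bigr => i _; rewrite scale_lfunE.
    by rewrite ym addNr.
  move/psumr_eq0P => az.
  have {}az i : a i * ((v i m : R) + 1) = 0.
    by apply: az => // j _; rewrite mulr_ge0 // -lerBlDr sub0r.
  rewrite yE -[y0]scale1r -a1 scaler_suml; apply: eq_bigr => i _.
  have [->|ai] := eqVneq (a i) 0; first by rewrite !scale0r.
  congr (_ *: _); rewrite (uniqY _ y0Y y0m); apply: uniqY; first exact: vY.
  by move/eqP: (az i); rewrite mulf_eq0 (negPf ai) /= addr_eq0 => /eqP.
(* A factor [k] of [y0] divides its value -1 at the lattice point [m]. *)
have prim : primitive_vect (dual_lattice M) y0.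
  split=> [|k z zN y0z]; first exact: Yint.
  have : (z m : R) *+ k = -1.
    by rewrite -y0m y0z; elim: k {y0z} => [|k IH]; rewrite ?mulr0n ?lfunE // !mulrS add_lfunE IH.
  have /intrP[a ->] := zN _ Mm; rewrite -mulr_natl -[-1]/((-1)%:~R) -[k%:R]/((k%:Z)%:~R) -intrM.
  move/intr_inj/(congr1 absz); rewrite abszM absz_nat abszN absz1 => /eqP.
  by rewrite muln_eq1 => /andP[/eqP].
suff -> : eta M P m = y0.
  split=> // y yY yy0; have /intrP[a ya] := Yint yY Mm.
  have : -1 <= (y m : R) by apply: Yge => //; exact: FP.
  rewrite ya -[-1]/((-1)%:~R) ler_int ler0z le_eqVlt => /predU1P[a1|].
    case/eqP: yy0; apply: Ym => [x|]; first exact: Yge.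
    by rewrite ya -a1.
  by case: a {ya} => // -[].
rewrite /eta; case: xgetP => [y _ [_ [F' [_ F'm yP F'E]]]|none].
  by apply: Ym => //; move: F'm; rewrite F'E => -[].
case: (none y0); split=> //; exists F; split=> // x; exact: Yge.
Qed.

(** Away from the two normals, [root_values] for [m] and for [- m] bounds the value by 0 from both
    sides. *)
Lemma semisimple_root_values m : semisimple_roots M P m ->
  [/\ eta M P m \in Y, eta M P (- m) \in Y, eta M P m != eta M P (- m) &
      forall y, y \in Y ->
        (y m : R) = (y == eta M P (- m))%:R - (y == eta M P m)%:R].
Proof.
move=> [/root_values[e1 m1 p1] /root_values[e2 m2 p2]].
have m2' : (eta M P (- m) m : R) = 1 by apply: oppr_inj; rewrite -linearN.
have e12 : eta M P m != eta M P (- m).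
  by apply/eqP => E; move: m1; rewrite E m2' => ?; lra.
split=> // y yY; have [->|n2] := eqVneq y (eta M P (- m)).
  by rewrite eq_sym (negPf e12) subr0.
have [->|n1] := eqVneq y (eta M P m); first by rewrite sub0r.
rewrite subrr; apply/le_anti; rewrite p1 // andbT -oppr_ge0 -linearN p2 //.
Qed.

End Reflexive.

(** If [Y] did not separate two points, [P] would contain the line through the origin in the
    direction of their difference, whereas functionals are bounded below on a convex hull of
    finitely many points. *)
Lemma dual_vertices_separate (s : seq V) P Y : P = conv_hull [set` s] ->
  P = [set x | forall y, y \in Y -> -1 <= (y x : R)] ->
  forall x x', (forall y, y \in Y -> (y x : R) = y x') -> x = x'.
Proof.
move=> Ps PE x x' xx'; apply/eqP; rewrite -subr_eq0; apply/eqP.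
apply: dual_separates => u; set z := x - x'.
have Pz (t : R) : P (t *: z).
  by rewrite PE => y yY; rewrite linearZ linearB /= xx' // subrr scaler0 lerN10.
have [c uc] : exists c, forall w, w \in s -> c <= (u w : R).
  exists (- \sum_(w <- s) `|(u w : R)|) => w ws.
  rewrite lerNl (big_rem w) //=; apply: (@le_trans _ _ `|(u w : R)|).
    by rewrite -normrN ler_norm.
  by rewrite lerDl sumr_ge0.
have ucP t : c <= t * (u z : R).
  have := Pz t; rewrite Ps => /(conv_hull_ge uc); by rewrite linearZ.
apply/eqP; apply: contrapT => /negP uz.
by have := ucP ((c - 1) / (u z : R)); rewrite divfK // lerBrDl gerDr ler10.
Qed.

End Roots.

(** * Lattices, isomorphisms and the dual simplex *)

Lemma big_tag (R : nmodType) (t : nat) (c : 'I_t -> nat) (F : {k : 'I_t & 'I_(c k)} -> R) i :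
  \sum_(s | tag s == i) F s = \sum_j F (Tagged (fun k => 'I_(c k)) (j : 'I_(c i))).
Proof.
have := @sig_big_dep R 0 +%R 'I_t (fun k => 'I_(c k)) (pred1 i) (fun=> predT)
  (fun k (j : 'I_(c k)) => F (Tagged (fun k => 'I_(c k)) j)).
rewrite big_pred1_eq => ->; apply: eq_big => [s|[k j] //]; by rewrite /= andbT.
Qed.

Section Lattices.
Variable R : realType.
Implicit Types V W : vectType R.

Lemma lattice_sum V (M : set V) (I : finType) (a : I -> R) (b : I -> V) :
  is_lattice M -> (forall i, a i \is a Num.int) -> (forall i, M (b i)) ->
  M (\sum_i a i *: b i).
Proof.
move=> [e _ ->] aint bM.
pose n i := sval (cid (intrP (aint i))).
have aE i : a i = (n i)%:~R by rewrite /n; case: cid.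
pose z i := sval (cid (bM i)).
have bE i : b i = \sum_(j < \dim {:V}) (z i j)%:~R *: e`_j by rewrite /z; case: cid.
exists (fun j => \sum_i n i * z i j).
under eq_bigr do rewrite bE scaler_sumr; rewrite exchange_big.
apply: eq_bigr => j _; rewrite raddf_sum scaler_suml; apply: eq_bigr => i _.
by rewrite scalerA aE /= intrM.
Qed.

(** [S1] and [S2] stand for the spans of the lattices: [f] is linear on the ambient space, but
    inverse to [g] only between these sets. *)
Lemma lattice_polytope_iso_intro V W (L1 P1 S1 : set V) (L2 P2 S2 : set W)
    (f : V -> W) (g : W -> V) : linear f ->
  (forall x, S1 x -> S2 (f x) /\ g (f x) = x) ->
  (forall y, S2 y -> S1 (g y) /\ f (g y) = y) ->
  (forall x, S1 x -> L1 x <-> L2 (f x)) -> (forall x, S1 x -> P1 x <-> P2 (f x)) ->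
  L1 `<=` S1 -> P1 `<=` S1 -> L2 `<=` S2 -> P2 `<=` S2 ->
  lattice_polytope_iso L1 P1 L2 P2.
Proof.
move=> lf fg gf Lf Pf L1S P1S L2S P2S; exists (linfun f); split; last first.
  apply/seteqP; split=> [_ [x Px <-]|y Py].
    by rewrite linfunE //; apply/Pf => //; exact: P1S.
  have [gyS fgy] := gf _ (P2S _ Py); exists (g y); last by rewrite linfunE.
  by apply/Pf; rewrite ?fgy.
split=> [x Lx|x x'|y Ly].
- by rewrite linfunE //; apply/Lf => //; exact: L1S.
- rewrite !inE !linfunE // => /L1S/fg[_ xE] /L1S/fg[_ x'E] E.
  by rewrite -xE E x'E.
- have [gyS fgy] := gf _ (L2S _ Ly); exists (g y); last by rewrite linfunE.
  by apply/Lf; rewrite ?fgy.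
Qed.

Lemma dual_simplexP k (y : 'rV[R]_k) :
  dual_simplex y <-> (forall j, -1 <= y 0 j) /\ \sum_j y 0 j <= 1.
Proof.
have fl : linear (fun x : 'rV[R]_k => \sum_i x 0 i * y 0 i : R^o).
  move=> a v w; rewrite scaler_sumr -big_split; apply: eq_bigr => i _ /=.
  by rewrite !mxE mulrDl /GRing.scale /= mulrA.
have fe j : \sum_i (delta_mx 0 j : 'rV[R]_k) 0 i * y 0 i = y 0 j.
  rewrite (bigD1 j) //= big1 => [|i ij]; first by rewrite mxE !eqxx mul1r addr0.
  by rewrite mxE (negPf ij) andbF mul0r.
have fs : \sum_i (- \sum_j delta_mx 0 j : 'rV[R]_k) 0 i * y 0 i = - \sum_j y 0 j.
  rewrite -[RHS]sumrN; apply: eq_bigr => i _; rewrite mxE summxE (bigD1 i) //= big1 => [|j ij].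
    by rewrite mxE !eqxx addr0 mulN1r.
  by rewrite mxE eq_sym (negPf ij) andbF.
split=> [yS|[y1 ys] x xS].
  split=> [j|]; first by rewrite -fe; apply: yS; apply: sub_conv_hull; left; exists j.
  by rewrite -lerN2 -fs; apply: yS; apply: sub_conv_hull; right.
have := @conv_hull_ge _ _ _ (linfun (fun x : 'rV[R]_k => \sum_i x 0 i * y 0 i : R^o)) (-1) _ x xS.
rewrite linfunE //; apply=> z [[j _ <-]|->]; rewrite linfunE //.
  by rewrite fe.
by rewrite fs lerN2.
Qed.

End Lattices.

(** * Coordinates from vectors with values -1, 0 and 1 on [Y] *)

Section Coordinates.
Variables (R : realType) (V : vectType R) (M P : set V) (Y : seq 'Hom(V, R^o)).
Hypothesis lM : is_lattice M.
Hypothesis Yint : forall y, y \in Y -> dual_lattice M y.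
Hypothesis PE : P = [set x | forall y, y \in Y -> -1 <= (y x : R)].
Variables (t : nat) (c : 'I_t -> nat).
Notation T := {k : 'I_t & 'I_(c k)}.
Variables (b : T -> V) (p q : T -> 'Hom(V, R^o)).
Hypothesis bM : forall s, M (b s).
Hypothesis pY : forall s, p s \in Y.
Hypothesis qY : forall s, q s \in Y.
Hypothesis b_val : forall (y : 'Hom(V, R^o)) s, y \in Y ->
  (y (b s) : R) = (y == q s)%:R - (y == p s)%:R.
Hypothesis p_inj : injective p.
Hypothesis pq : forall s s', p s != q s'.
Hypothesis q_tag : forall s s', (q s == q s') = (tag s == tag s').

(** The sign reflects that a root is -1 on its own normal; up to it, the [p s] are dual to the
    [b s]. *)
Lemma pb s s' : (p s (b s') : R) = - (s == s')%:R.
Proof. by rewrite b_val // (negPf (pq _ _)) sub0r (inj_eq p_inj). Qed.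

Lemma p_comb (a : T -> R) s : (p s (\sum_s' a s' *: b s') : R) = - a s.
Proof.
rewrite linear_sum (bigD1 s) //= linearZ big1 => [|s' ss'].
  by rewrite addr0 /= pb eqxx /GRing.scale /= mulrN1.
by rewrite linearZ /= pb eq_sym (negPf ss') oppr0 scaler0.
Qed.

Lemma comb_p x : x \in lin (range b) -> x = \sum_s - (p s x : R) *: b s.
Proof.
move=> /mem_lin_range[a ->]; apply: eq_bigr => s _; by rewrite p_comb opprK.
Qed.

Lemma coordinates_inj x x' : x \in lin (range b) -> x' \in lin (range b) ->
  (forall s, (p s x : R) = p s x') -> x = x'.
Proof.
move=> xb x'b E; rewrite (comb_p xb) (comb_p x'b).
by apply: eq_bigr => s _; rewrite E.
Qed.

(** The [p s] are integral on [M] and unimodular on the [b s], which hence generate the full lattice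
    of their span and not a proper sublattice. *)
Lemma lattice_coordinates x : x \in lin (range b) ->
  M x <-> forall s, (p s x : R) \is a Num.int.
Proof.
move=> xb; split=> [Mx s|pint]; first exact: Yint Mx.
rewrite (comb_p xb); apply: lattice_sum => // s; by rewrite rpredN.
Qed.

(** On the vectors [b s'], [q s] is 1 within its own block and 0 elsewhere; its inequality is the
    one that bounds the block to a simplex. *)
Lemma q_coordinates x s : x \in lin (range b) ->
  (q s x : R) = - \sum_(s' | tag s' == tag s) (p s' x : R).
Proof.
move=> xb; rewrite {1}(comb_p xb) linear_sum -sumrN [RHS]big_mkcond /=.
apply: eq_bigr => s' _; rewrite linearZ /= b_val // q_tag eq_sym.
rewrite [q s == _]eq_sym (negPf (pq _ _)) subr0 /GRing.scale /=.
by case: eqP; rewrite ?mulr1 ?mulr0.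
Qed.

(** An element of [Y] that is none of the [p s] and [q s] vanishes on the span, so it imposes no
    condition there. *)
Lemma polytope_coordinates x : x \in lin (range b) ->
  P x <-> (forall s, -1 <= (p s x : R)) /\
          (forall i, \sum_(s | tag s == i) (p s x : R) <= 1).
Proof.
move=> xb; split=> [|[xp xq]].
  rewrite PE /= => xY; split=> [s|i]; first exact: xY.
  have [[s /eqP <-]|none] := pselect (exists s : T, tag s == i).
    by rewrite -lerN2 -q_coordinates // xY.
  (* An empty block has no [q s]; its condition reads [0 <= 1]. *)
  by rewrite big1 ?ler01 // => s si; case: none; exists s.
rewrite PE => y yY /=; have [[s ->//]|np] := pselect (exists s, y = p s).
have [[s ->]|nq] := pselect (exists s, y = q s).
  by rewrite q_coordinates // lerN2.
rewrite (comb_p xb) linear_sum big1 ?lerN10 // => s _.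
rewrite linearZ /= b_val //; case: eqP => [E|_]; first by case: nq; exists s.
by case: eqP => [E|_]; [case: np; exists s|rewrite subrr scaler0].
Qed.

Notation block i := (b @` [set s | tag s = i]).

Lemma block_sub i x : x \in lin (block i) -> x \in lin (range b).
Proof. by apply/subvP/linS => _ [s _ <-]; exists s. Qed.

Lemma p_block i x s : x \in lin (block i) -> tag s != i -> (p s x : R) = 0.
Proof.
move=> xi si; apply/eqP; rewrite -memv_ker; move: xi; apply/subvP/lin_sub.
move=> _ [s' s'i <-]; rewrite memv_ker pb (_ : s == s' = false) ?oppr0 //.
by apply: contraNF si => /eqP ->; rewrite -s'i.
Qed.

Lemma mem_block_comb i (a : T -> R) : \sum_(s | tag s == i) a s *: b s \in lin (block i).
Proof.
by apply: memv_suml => s /eqP si; rewrite memvZ // mem_lin //; exists s.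
Qed.

Lemma p_block_comb i (a : T -> R) s :
  (p s (\sum_(s | tag s == i) a s *: b s) : R) = if tag s == i then - a s else 0.
Proof.
case: ifPn => [/eqP <-|si]; last exact: p_block (mem_block_comb _ _) si.
have := p_comb (fun s' => if tag s' == tag s then a s' else 0) s; rewrite eqxx => <-.
congr (p s _); rewrite big_mkcond; apply: eq_bigr => s' _.
by case: eqP; rewrite ?scale0r.
Qed.

(** The expansion of [comb_p] cut into blocks, but taken on all of [V]: [lattice_polytope_iso] asks
    for a map linear on the ambient space. *)
Definition block_split (x : V) : {ffun 'I_t -> V} :=
  [ffun i => \sum_(s | tag s == i) - (p s x : R) *: b s].

Definition block_coordinates (h : {ffun 'I_t -> V}) : 'rV[R]_(\sum_i c i) :=
  \row_k (p (tagnat.sig k) (h (tagnat.sig1 k)) : R).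

Lemma block_split_linear : linear block_split.
Proof.
move=> a x y; apply/ffunP => i; rewrite !ffunE scaler_sumr -big_split.
apply: eq_bigr => s _ /=; rewrite linearP scalerA -scalerDl.
by rewrite /GRing.scale /= opprD mulrN.
Qed.

Lemma block_coordinates_linear : linear block_coordinates.
Proof. by move=> a g h; apply/rowP => k; rewrite !mxE !ffunE linearP. Qed.

Lemma block_sum_coordinates (h : {ffun 'I_t -> V}) s :
  (forall i, h i \in lin (block i)) -> (p s (\sum_i h i) : R) = p s (h (tag s)).
Proof.
move=> hb; rewrite linear_sum (bigD1 (tag s)) //= big1 ?addr0 // => i si.
by apply: p_block (hb i) _; rewrite eq_sym.
Qed.

(** The inverse adds up the components. Each condition of [polytope_coordinates] involves the
    coordinates of one block only. *)
Lemma block_split_iso :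
  lattice_polytope_iso
    (M `&` [set` lin (range b)]) (P `&` [set` lin (range b)])
    (direct_sum (fun i => M `&` [set` lin (block i)]))
    (direct_sum (fun i => P `&` [set` lin (block i)])).
Proof.
have splitb x i : block_split x i \in lin (block i).
  by rewrite ffunE; exact: mem_block_comb.
have psplit x s i : (p s (block_split x i) : R) = if tag s == i then p s x else 0.
  by rewrite ffunE p_block_comb opprK.
have comb_split x : x \in lin (range b) -> \sum_i block_split x i = x.
  move=> xb; apply: coordinates_inj => // [|s]; last first.
    by rewrite block_sum_coordinates // psplit eqxx.
  by apply: memv_suml => i _; exact: block_sub (splitb x i).
apply: (@lattice_polytope_iso_intro _ _ _ _ _ [set` lin (range b)] _ _
  [set h : {ffun 'I_t -> V} | forall i, h i \in lin (block i)]
  block_split (fun h => \sum_i h i)).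
- exact: block_split_linear.
- by move=> x /= xb; split=> //; exact: comb_split.
- move=> h /= hb; have sb : \sum_i h i \in lin (range b).
    by apply: memv_suml => i _; exact: block_sub (hb i).
  split=> //; apply/ffunP => i.
  apply: coordinates_inj => [||s]; [exact: block_sub (splitb _ _)|exact: block_sub (hb i)|].
  rewrite psplit block_sum_coordinates //; case: eqP => [->//|/eqP si].
  by rewrite (p_block (hb i)).
- move=> x /= xb; split=> [[Mx _] i|Ms].
    split; last exact: splitb.
    apply/(lattice_coordinates (block_sub (splitb x i))) => s.
    by rewrite psplit; case: ifP => // _; exact: Yint (pY s) _ Mx.
  split=> //; apply/lattice_coordinates => // s.
  have := psplit x s (tag s); rewrite eqxx => <-.
  by case: (Ms (tag s)) => /(lattice_coordinates (block_sub (splitb x (tag s)))).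
- move=> x /= xb; split=> [[Px _] i|Ps].
    have /(_ Px)[xp xq] := proj1 (polytope_coordinates xb).
    split; last exact: splitb.
    apply/polytope_coordinates; first exact: block_sub (splitb _ _).
    split=> [s|k]; first by rewrite psplit; case: ifP.
    under eq_bigr do rewrite psplit.
    have [<-|ki] := eqVneq k i; first by under eq_bigr => s sk do rewrite sk.
    by rewrite big1 // => s /eqP ->; rewrite (negPf ki).
  have Pc i : (forall s, tag s = i -> -1 <= (p s x : R)) /\ \sum_(s | tag s == i) (p s x : R) <= 1.
    have [/(polytope_coordinates (block_sub (splitb x i)))[sp sq] _] := Ps i.
    split=> [s si|]; first by have := sp s; rewrite psplit si eqxx.
    by have := sq i; under eq_bigr => s si do rewrite psplit si.
  split=> //; apply/polytope_coordinates => //; split=> [s|i]; last by case: (Pc i).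
  by case: (Pc (tag s)) => + _; apply.
- by move=> x [].
- by move=> x [].
- by move=> h hb i; case: (hb i).
- by move=> h hb i; case: (hb i).
Qed.

Lemma block_coordinates_iso :
  lattice_polytope_iso
    (direct_sum (fun i => M `&` [set` lin (block i)]))
    (direct_sum (fun i => P `&` [set` lin (block i)]))
    (@int_lattice R (\sum_i c i))
    (direct_sum_rV (fun i => @dual_simplex R (c i))).
Proof.
pose g (r : 'rV[R]_(\sum_i c i)) : {ffun 'I_t -> V} :=
  [ffun i => \sum_(s | tag s == i) - r 0 (tagnat.rank s) *: b s].
have gb r i : g r i \in lin (block i) by rewrite ffunE; exact: mem_block_comb.
have pg r s : (p s (g r (tag s)) : R) = r 0 (tagnat.rank s).
  by rewrite ffunE p_block_comb eqxx opprK.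
have coordE h s : block_coordinates h 0 (tagnat.rank s) = p s (h (tag s)).
  by rewrite mxE /tagnat.sig1 tagnat.rankK.
have blockE h i s : h i \in lin (block i) ->
    (p s (h i) : R) = if tag s == i then p s (h (tag s)) else 0.
  by move=> hb; case: eqP => [->//|/eqP]; exact: p_block.
apply: (@lattice_polytope_iso_intro _ _ _ _ _
  [set h : {ffun 'I_t -> V} | forall i, h i \in lin (block i)] _ _ setT
  block_coordinates g).
- exact: block_coordinates_linear.
- move=> h /= hb; split=> //; apply/ffunP => i.
  apply: coordinates_inj => [||s]; [exact: block_sub (gb _ _)|exact: block_sub (hb i)|].
  rewrite (blockE h) // (blockE (g _)) //; case: ifP => // _.
  by rewrite pg coordE.
- move=> r _; split=> [i //|]; apply/rowP => k.
  by rewrite -(tagnat.sigK k) coordE pg.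
- move=> h /= hb; split=> [Mh k|hint i].
    by rewrite -(tagnat.sigK k) coordE; case: (Mh (tag (tagnat.sig k))) => + _; exact: Yint (pY _) _.
  split; last exact: hb.
  apply/(lattice_coordinates (block_sub (hb i))) => s.
  by rewrite blockE //; case: ifP => // _; rewrite -coordE.
- move=> h /= hb.
  have subE i j : submxrow (block_coordinates h) i 0 j =
      p (Tagged (fun k => 'I_(c k)) j) (h i) by rewrite mxE coordE.
  split=> [Ph i|hD i].
    have [/(polytope_coordinates (block_sub (hb i)))[hp hq] _] := Ph i.
    apply/dual_simplexP; split=> [j|]; first by rewrite subE.
    under eq_bigr do rewrite subE.
    by rewrite -(big_tag (fun s => p s (h i) : R)).
  have /dual_simplexP[hp hq] := hD i.
  split; last exact: hb.
  apply/polytope_coordinates; first exact: block_sub (hb i).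
  split=> [[k j]|k].
    rewrite blockE //=; case: eqP => [ki|//]; subst k.
    by rewrite -subE.
  have [->|ki] := eqVneq k i.
    rewrite (big_tag (fun s => p s (h i) : R)).
    by under eq_bigr do rewrite -subE.
  by rewrite big1 // => s /eqP si; rewrite (p_block (hb i)) // si.
- by move=> h hb i; case: (hb i).
- by move=> h hb i; case: (hb i).
- by [].
- by [].
Qed.

End Coordinates.

(** * The isomorphisms for a root basis *)

Section RootBasis.
Variables (R : realType) (V : vectType R) (M P : set V) (Y : seq 'Hom(V, R^o)).
Hypothesis lM : is_lattice M.
Hypothesis P0 : near_vect 0 P.
Hypothesis PE : P = [set x | forall y, y \in Y -> -1 <= (y x : R)].
Hypothesis YE : dual_polytope P = conv_hull [set` Y].
Hypothesis Yint : forall y, y \in Y -> dual_lattice M y.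

(** Enumerating every class indexes [B] by pairs of a class and a position, which brings the root
    basis into the shape of the coordinate lemmas, with the classes as blocks. *)
Lemma root_basis_iso (A B : set V) (t : nat) (C : 'I_t -> set V) (c : 'I_t -> nat) :
  B `<=` semisimple_roots M P -> root_basis M P A B ->
  set_bij [set: 'I_t] (equiv_classes M P B) C -> (forall i, (C i #= `I_(c i))%card) ->
  lattice_polytope_iso (M `&` [set` lin A]) (P `&` [set` lin A])
    (direct_sum (fun i => M `&` [set` lin (C i)]))
    (direct_sum (fun i => P `&` [set` lin (C i)])) /\
  lattice_polytope_iso
    (direct_sum (fun i => M `&` [set` lin (C i)]))
    (direct_sum (fun i => P `&` [set` lin (C i)]))
    (@int_lattice R (\sum_i c i))
    (direct_sum_rV (fun i => @dual_simplex R (c i))).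
Proof.
move=> BS [_ BA orth AE] [Cclass Cinj Csurj] Ccard.
have beta_ i : exists f : 'I_(c i) -> V, injective f /\ range f = C i.
  have /card_set_bijP[g [gC ginj gsurj]] := Ccard i.
  have H (j : 'I_(c i)) : exists v, C i v /\ g v = j.
    by have [v Cv gv] := gsurj j (ltn_ord j); exists v.
  pose f j := sval (cid (H j)).
  have fC j : C i (f j) by rewrite /f; case: cid => ? [].
  have gf j : g (f j) = j by rewrite /f; case: cid => ? [].
  exists f; split=> [j k E|]; first by apply: val_inj; rewrite /= -!gf E.
  apply/seteqP; split=> [_ [j _ <-]//|v Cv]; exists (Ordinal (gC _ Cv)) => //.
  by apply: ginj; rewrite ?inE // gf.
pose beta i := sval (cid (beta_ i)).
have beta_inj i : injective (beta i) by rewrite /beta; case: cid => ? [].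
have beta_range i : range (beta i) = C i by rewrite /beta; case: cid => ? [].
have CP i : exists2 v, B v & C i = [set w | B w /\ equiv_roots M P v w].
  by have [|v Bv <-] := Cclass i; last exists v.
pose T := {k : 'I_t & 'I_(c k)}.
pose b (s : T) := beta (tag s) (tagged s).
have bC s : C (tag s) (b s) by rewrite -beta_range; exists (tagged s).
have Cb i v : C i v -> exists2 s : T, tag s = i & b s = v.
  by rewrite -beta_range => -[j _ <-]; exists (Tagged (fun k => 'I_(c k)) j).
have CB i v : C i v -> B v by have [w _ ->] := CP i; case.
have bB s : B (b s) := CB _ _ (bC s).
have Ceq i v w : C i v -> C i w <-> B w /\ equiv_roots M P v w.
  have [u _ ->] := CP i; rewrite /= /equiv_roots => -[_ ->]; by [].
have Bb v : B v -> exists s, b s = v.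
  move=> Bv; have [|i _ Ci] := Csurj [set w | B w /\ equiv_roots M P v w].
    by exists v.
  by have [|s _ sv] := Cb i v; [rewrite Ci|exists s].
have tag_equiv s s' : (eta M P (- b s) == eta M P (- b s')) = (tag s == tag s').
  apply/eqP/eqP => [E|ss']; last first.
    by have /(Ceq _ _ _ (bC s))[] : C (tag s) (b s') by rewrite ss'.
  apply: Cinj; rewrite ?inE //; apply/seteqP; split=> w.
    move/(Ceq _ _ _ (bC s)) => [Bw ew]; apply/(Ceq _ _ _ (bC s')); split=> //.
    by rewrite /equiv_roots -E.
  move/(Ceq _ _ _ (bC s')) => [Bw ew]; apply/(Ceq _ _ _ (bC s)); split=> //.
  by rewrite /equiv_roots E.
have b_inj : injective b.
  move=> s s' E; have ss' : tag s = tag s' by apply/eqP; rewrite -tag_equiv E.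
  case: s s' ss' E => i j [i' j'] /= ii'; subst i'; rewrite /b /= => E.
  by congr (Tagged _ _); exact: beta_inj E.
have semis s := semisimple_root_values P0 PE YE Yint (BS _ (bB s)).
pose p s := eta M P (b s); pose q s := eta M P (- b s).
have pY s : p s \in Y by case: (semis s).
have qY s : q s \in Y by case: (semis s).
have bM s : M (b s) by case: (BS _ (bB s)) => -[].
have b_val (y : 'Hom(V, R^o)) s : y \in Y -> (y (b s) : R) = (y == q s)%:R - (y == p s)%:R.
  by case: (semis s) => _ _ _; apply.
have pqs s : p s != q s by case: (semis s).
have porth s s' : s != s' -> (p s (b s') : R) = 0.
  move=> /eqP ss'; have [//|+ _] := orth (b s) (b s') (bB s) (bB s').
    by move/b_inj.
  exact.
(* For distinct indices, [p s = p s'] would make the value at [b s'] both 0, by orthogonality, and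
   -1; [p s = q s'], excluded next, would make it both 0 and 1. *)
have p_inj : injective p.
  move=> s s' E; apply/eqP; apply: contraT => /porth; rewrite b_val // E eqxx.
  by rewrite (negPf (pqs _)) sub0r => /eqP; rewrite oppr_eq0 oner_eq0.
have pq s s' : p s != q s'.
  have [<-//|ss'] := eqVneq s s'; apply/eqP => E.
  have := porth _ _ ss'; rewrite b_val // E eqxx eq_sym (negPf (pqs _)) subr0.
  by move/eqP; rewrite oner_eq0.
have CE : C = fun i => b @` [set s | tag s = i].
  apply/funext => i; apply/seteqP; split=> [v /Cb[s si <-]|_ [s /= <- <-]].
    by exists s.
  exact: bC.
have linA : lin A = lin (range b).
  apply/eqP; rewrite eqEsubv; apply/andP; split.
    apply: lin_sub => x; rewrite AE => -[_ /=]; apply/subvP/lin_sub => v /Bb[s <-].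
    by apply: mem_lin; exists s.
  by apply: linS => _ [s _ <-]; exact: BA.
rewrite linA CE; split.
  exact: (block_split_iso lM Yint PE bM pY qY b_val p_inj pq tag_equiv).
exact: (block_coordinates_iso lM Yint PE bM pY qY b_val p_inj pq tag_equiv).
Qed.

End RootBasis.

(** * The face fan when the generators of each block sum to zero *)

Section BlockFan.
Variables (R : realType) (X : vectType R) (I K : finType) (kappa : I -> K) (y : I -> X).

(** The origin keeps the hull nonempty when there are no generators at all, as for a polytope
    without blocks. *)
Definition with_origin (o : option I) : X := if o is Some i then y i else 0.

Definition misses_every_block (S : {set I}) := forall k, exists2 i, kappa i = k & i \notin S.

Local Notation Q := (conv_hull (range with_origin)).

Lemma with_origin_in o : Q (with_origin o).
Proof. by apply: sub_conv_hull; exists o. Qed.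

(** As [c < 0], the origin is not on the face, and slackness leaves only the generators at level
    [c]. *)
Lemma pos_hull_face (u : 'Hom(X, R^o)) (c : R) :
  c < 0 -> (forall i, c <= (u (y i) : R)) ->
  pos_hull (Q `&` [set x | (u x : R) = c]) =
  pos_hull (y @` [set` [set i | (u (y i) : R) == c]%SET]).
Proof.
move=> c0 uc; apply/seteqP; split.
  apply: pos_hull_sub_cone => x [/conv_hull_range[a [a0 a1 ->]] /= ux].
  have uo o : c <= (u (with_origin o) : R).
    by case: o => [i|] //=; rewrite linear0 ltW.
  have az := conv_hull_ge_eq uo a0 a1 ux.
  apply/pos_hull_range; exists (a \o Some) => //=.
  rewrite (bigD1 None) //= scaler0 add0r.
  rewrite [LHS](reindex_omap Some id) /=; last by case.
  rewrite [RHS]big_mkcond /=; apply: eq_big => [i|i _]; first by rewrite eqxx.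
  rewrite inE; case: (az (Some i)) => [->|->]; first by rewrite !scale0r if_same.
  by rewrite eqxx.
apply: pos_hullS => _ [i /= ic <-]; split; last by move: ic; rewrite inE => /eqP.
exact: (with_origin_in (Some i)).
Qed.

Hypothesis kappa_surj : forall k, exists i, kappa i = k.
Hypothesis y_sum : forall k, \sum_(i | kappa i == k) y i = 0.
Hypothesis y_interpolate : forall v : I -> R, (forall k, \sum_(i | kappa i == k) v i = 0) ->
  exists u : 'Hom(X, R^o), forall i, (u (y i) : R) = v i.

(** A functional sums to zero over each block, so it cannot be equal to a negative bound [c] on an
    entire block; the bound 0 would make the face all of [Q]. Conversely, a set missing an element
    of every block is cut out by interpolation. The empty set gives the cone consisting of 0. *)
Lemma face_fan_blocks :
  face_fan Q = [set C | exists2 S : {set I}, misses_every_block S & C = pos_hull (y @` [set` S])].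
Proof.
apply/seteqP; split=> [_ [F [[u [c [uc FE]]] FQ] <-]|_ [S Smiss ->]].
  have uy i : c <= (u (y i) : R) := uc _ (with_origin_in (Some i)).
  have usum k : \sum_(i | kappa i == k) (u (y i) : R) = 0.
    by have := congr1 u (y_sum k); rewrite linear_sum linear0.
  have : c <= 0 by rewrite -(linear0 u); exact: uc (with_origin_in None).
  rewrite le_eqVlt => /predU1P[c0|c0].
    exfalso; apply: FQ; rewrite FE; apply/seteqP; split=> [x []//|x Qx].
    split=> //=; rewrite c0; case/conv_hull_range: Qx => a [_ _ ->].
    rewrite linear_sum big1 // => -[i|] _; rewrite linearZ /= ?linear0 ?scaler0 //.
    have /psumr_eq0P uy0 := usum (kappa i).
    by rewrite uy0 ?scaler0 // => j _; rewrite -c0.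
  exists [set i | (u (y i) : R) == c]%SET; last by rewrite FE pos_hull_face.
  move=> k; apply: contrapT => none.
  have uk i : kappa i = k -> (u (y i) : R) = c.
    move=> ik; apply/eqP; apply: contrapT => uic; apply: none.
    by exists i => //; rewrite inE; apply/negP.
  have := usum k; under eq_bigr => i /eqP ik do rewrite uk //.
  have [i0 i0k] := kappa_surj k.
  rewrite (bigD1 i0) ?i0k //=; apply/eqP; rewrite lt_eqF //.
  apply: (le_lt_trans _ c0); rewrite gerDl sumr_le0 // => i _; exact: ltW.
pose m k : nat := #|[set i | (kappa i == k) && (i \in S)]%SET|.
pose n k : nat := #|[set i | (kappa i == k) && (i \notin S)]%SET|.
have n0 k : (n k)%:R != 0 :> R.
  have [i ik iS] := Smiss k; rewrite pnatr_eq0 -lt0n card_gt0.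
  by apply/set0Pn; exists i; rewrite inE ik eqxx.
(* The value off [S] balances the values -1 in the same block; being nonnegative, it leaves exactly
   [S] at level -1. *)
pose v i : R := if i \in S then -1 else (m (kappa i))%:R / (n (kappa i))%:R.
have [k|u uv] := y_interpolate (v := v).
  rewrite (bigID (mem S)) /=.
  rewrite (eq_bigr (fun=> -1)) => [|i /andP[_ iS]]; last by rewrite /v iS.
  rewrite [X in _ + X](eq_bigr (fun=> (m k)%:R / (n k)%:R)); last first.
    by move=> i /andP[/eqP ik iS]; rewrite /v (negPf iS) ik.
  rewrite !sumr_const -[_ *+ _]mulr_natr -[X in _ + X]mulr_natr.
  have -> : #|[pred i | (kappa i == k) && (i \in S)]%SET| = m k.
    by apply: eq_card => i; rewrite !inE.
  have -> : #|[pred i | (kappa i == k) && (i \notin S)]| = n k.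
    by apply: eq_card => i; rewrite !inE.
  by rewrite divfK // mulN1r addNr.
have v_ge i : -1 <= v i.
  by rewrite /v; case: ifP => // _; rewrite (@le_trans _ _ 0) ?lerN10 // divr_ge0.
exists (Q `&` [set x | (u x : R) = -1]).
  split; last first.
    move=> /seteqP[_ /(_ _ (with_origin_in None))[_]] /=; rewrite linear0 => /eqP.
    by rewrite eq_sym oppr_eq0 oner_eq0.
  exists u, (-1); split=> // ; apply: conv_hull_ge => _ [[i|] _ <-] /=.
    by rewrite uv.
  by rewrite linear0 lerN10.
rewrite pos_hull_face ?ltrN10 //; last by move=> i; rewrite uv.
congr (pos_hull (y @` _)); apply/seteqP; split=> i /=; rewrite inE uv /v.
  case: ifP => // _ /eqP E; have := divr_ge0 (ler0n R (m (kappa i))) (ler0n R (n (kappa i))).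
  by rewrite E oppr_ge0 ler10.
by move=> ->.
Qed.

End BlockFan.

Lemma sum_option (W : nmodType) (J : finType) (F : option J -> W) :
  \sum_o F o = F None + \sum_j F (Some j).
Proof.
rewrite (bigD1 None) //=; congr (_ + _).
by rewrite (reindex_omap Some id) /=; [apply: eq_bigl => i; rewrite eqxx|case].
Qed.

(** The weight of the origin is spread evenly over the [y i]; [i0] ensures that there is at least
    one of them. *)
Lemma conv_hull_with_origin (R : realType) (X : vectType R) (I : finType) (y : I -> X) (i0 : I) :
  \sum_i y i = 0 -> conv_hull (range (with_origin y)) = conv_hull (range y).
Proof.
move=> y0; apply/seteqP; split=> x /conv_hull_range[a [a0 a1 ->]]; apply/conv_hull_range.
  have I0 : (#|I|%:R : R) != 0 by rewrite pnatr_eq0 -lt0n; apply/card_gt0P; exists i0.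
  exists (fun i => a (Some i) + a None / #|I|%:R); split.
  - by move=> i; rewrite addr_ge0 // divr_ge0.
  - by rewrite big_split /= sumr_const -[X in _ + X]mulr_natr divfK // addrC -sum_option.
  rewrite sum_option /= scaler0 add0r.
  under [RHS]eq_bigr do rewrite scalerDl.
  by rewrite big_split /= -scaler_sumr y0 scaler0 addr0.
exists (fun o => if o is Some i then a i else 0); split.
- by case.
- by rewrite sum_option add0r.
by rewrite sum_option scaler0 add0r.
Qed.

(** * The fan of projective space *)

Section ProjectiveFan.
Variables (R : realType) (k : nat).

Definition simplex_vertex (o : option 'I_k) : 'rV[R]_k :=
  if o is Some j then delta_mx 0 j else - \sum_j delta_mx 0 j.

(** The case of a single block: the only relation between the vertices of the simplex is that they
    sum to zero. *)
Lemma projective_fanE :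
  @projective_fan R k = [set C | exists2 S : {set option 'I_k},
    exists o, o \notin S & C = pos_hull (simplex_vertex @` [set` S])].
Proof.
have z0 : \sum_o simplex_vertex o = 0 by rewrite sum_option addNr.
rewrite /projective_fan /simplex.
have -> : range (delta_mx 0) `|` [set - \sum_i delta_mx 0 i] = range simplex_vertex.
  apply/seteqP; split=> [_ [[j _ <-]|->]|_ [[j|] _ <-]]; first by exists (Some j).
  - by exists None.
  - by left; exists j.
  - by right.
rewrite -(conv_hull_with_origin None z0).
rewrite (face_fan_blocks (kappa := fun=> tt)).
- apply/seteqP; split=> [C [S Smiss ->]|C [S [x xS] ->]]; exists S => //.
    by have [x] := Smiss tt; exists x.
  by case; exists x.
- by case; exists None.
- by case; under eq_bigl do rewrite eqxx.
move=> v /(_ tt); under eq_bigl do rewrite eqxx; rewrite sum_option => vs.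
have ul : linear (fun r : 'rV[R]_k => \sum_j r 0 j * v (Some j) : R^o).
  move=> a r r'; rewrite scaler_sumr -big_split; apply: eq_bigr => j _ /=.
  by rewrite !mxE mulrDl -mulrA.
have ud j : linfun (fun r : 'rV[R]_k => \sum_j r 0 j * v (Some j) : R^o) (delta_mx 0 j) = v (Some j).
  rewrite linfunE // (bigD1 j) //= mxE !eqxx mul1r big1 ?addr0 // => i ij.
  by rewrite mxE (negPf ij) andbF mul0r.
exists (linfun (fun r : 'rV[R]_k => \sum_j r 0 j * v (Some j) : R^o)) => -[j|]; first exact: ud.
rewrite linearN linear_sum (eq_bigr (fun j => v (Some j))) => [|j _]; last exact: ud.
by apply/eqP; rewrite eqr_oppLR -addr_eq0 addrC vs.
Qed.

Lemma simplex_vertex_coord (o : option 'I_k) j :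
  simplex_vertex o 0 j = (o == Some j)%:R - (o == None)%:R.
Proof.
case: o => [i|] /=; first by rewrite mxE /= subr0 [j == i]eq_sym.
rewrite mxE summxE (bigD1 j) //= big1 => [|i ij]; first by rewrite mxE !eqxx addr0 sub0r.
by rewrite mxE eq_sym (negPf ij) andbF.
Qed.

Lemma simplex_cone (S : {set option 'I_k}) (r : 'rV[R]_k) :
  pos_hull (simplex_vertex @` [set` S]) r <->
  exists2 a : option 'I_k -> R, forall o, 0 <= a o &
    forall j, r 0 j = (if Some j \in S then a (Some j) else 0) - (if None \in S then a None else 0).
Proof.
have E (a : option 'I_k -> R) j : (\sum_(o in S) a o *: simplex_vertex o) 0 j =
    (if Some j \in S then a (Some j) else 0) - (if None \in S then a None else 0).
  rewrite summxE; under eq_bigr do rewrite mxE simplex_vertex_coord.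
  rewrite big_mkcond sum_option (bigD1 j) //= big1 => [|i ij].
    by rewrite eqxx subr0 sub0r mulr1 mulrN1 addr0 addrC; case: (None \in S); rewrite ?oppr0.
  by rewrite (inj_eq Some_inj) (negPf ij) subr0 mulr0 if_same.
split=> [/pos_hull_range[a a0 ->]|[a a0 ra]]; first by exists a.
by apply/pos_hull_range; exists a => //; apply/rowP => j; rewrite E ra.
Qed.

End ProjectiveFan.

(** * Products of dual simplices: reflexivity and normal fan *)

Section ProductModel.
Variables (R : realType) (W : vectType R) (t : nat) (c : 'I_t -> nat).
Notation T := {k : 'I_t & 'I_(c k)}.
Variables (w : T -> W) (p : T -> 'Hom(W, R^o)) (M P : set W).
Hypothesis pw : forall s s', (p s (w s') : R) = (s == s')%:R.
Hypothesis wp : forall x, x = \sum_s (p s x : R) *: w s.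
Hypothesis ME : forall x, M x <-> forall s, (p s x : R) \is a Num.int.
Hypothesis PE : forall x, P x <-> (forall s, -1 <= (p s x : R)) /\
  (forall i, \sum_(s | tag s == i) (p s x : R) <= 1).

Lemma p_w_comb (a : T -> R) s : (p s (\sum_s' a s' *: w s') : R) = a s.
Proof.
rewrite linear_sum (bigD1 s) //= linearZ big1 => [|s' ss'].
  by rewrite addr0 /= pw eqxx /GRing.scale /= mulr1.
by rewrite linearZ /= pw eq_sym (negPf ss') scaler0.
Qed.

Lemma model_lattice : is_lattice M.
Proof.
pose X := [tuple w (enum_val i) | i < #|{: T}|].
have XE (i : 'I_#|{: T}|) : X`_i = w (enum_val i) by rewrite -tnth_nth tnth_mktuple.
have Xsum (a : 'I_#|{: T}| -> R) : \sum_i a i *: X`_i = \sum_s a (enum_rank s) *: w s.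
  rewrite [RHS](reindex (@enum_val T xpredT)) /=; last exact/onW_bij/enum_val_bij.
  by apply: eq_bigr => i _; rewrite XE enum_valK.
have Xbasis : basis_of fullv X.
  rewrite /basis_of; apply/andP; split.
    rewrite eqEsubv subvf; apply/subvP => x _; rewrite (wp x); apply: memv_suml => s _.
    by rewrite memvZ // memv_span //; apply/mapP; exists (enum_rank s); rewrite ?mem_enum ?enum_rankK.
  apply/freeP => a; rewrite Xsum => a0 i.
  by have := p_w_comb (a \o enum_rank) (enum_val i); rewrite /= a0 linear0 enum_valK.
have dimT := esym (size_basis Xbasis).
have ME' : M = [set x | exists z : 'I_#|{: T}| -> int, x = \sum_i (z i)%:~R *: X`_i].
  apply/seteqP; split=> x; last first.
    by move=> [z ->]; apply/ME => s; rewrite Xsum (p_w_comb (fun s => (z (enum_rank s))%:~R)) intr_int.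
  move=> /ME xint; pose z s := sval (cid (intrP (xint s))).
  exists (z \o enum_val); rewrite Xsum {1}(wp x); apply: eq_bigr => s _ /=.
  by rewrite enum_rankK /z; case: cid => m /= ->.
rewrite /is_lattice; case: _ / dimT => //.
by exists X.
Qed.

(** The inner normals of the facets of the product. An empty block contributes the zero functional,
    matching the one-point simplex of dimension 0. *)
Definition block_normal (i : T + 'I_t) : 'Hom(W, R^o) :=
  match i with inl s => p s | inr k => - \sum_(s | tag s == k) p s end.

Lemma block_normalE k x :
  (block_normal (inr k) x : R) = - \sum_(s | tag s == k) (p s x : R).
Proof. by rewrite /= opp_lfunE sum_lfunE. Qed.

Lemma model_polytopeE : P = [set x | forall i, -1 <= (block_normal i x : R)].
Proof.
apply/seteqP; split=> x /=.
  by move/PE => [xp xq] [s|k]; [exact: xp|rewrite block_normalE lerN2].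
move=> xn; apply/PE; split=> [s|k]; first exact: (xn (inl s)).
by rewrite -lerN2 -block_normalE.
Qed.

Lemma model_interior : vect_interior P 0.
Proof.
have -> : P = [set x | forall y, y \in codom block_normal -> -1 <= (y x : R)].
  rewrite model_polytopeE; apply/seteqP; split=> x /= xP.
    by move=> _ /codomP[i ->].
  by move=> i; apply: xP; exact: codom_f.
by apply: near_vect_ge => y _; rewrite linear0 ltrN10.
Qed.

(* A block of the polytope is the simplex [p s >= -1], [\sum p s <= 1]; its    *)
(* vertices have all [p s] equal to [-1] but at most one, equal to [c i].      *)
Definition model_vertex (sigma : {ffun 'I_t -> option T}) : W :=
  \sum_s (-1 + (sigma (tag s) == Some s)%:R * (c (tag s)).+1%:R) *: w s.

Lemma sum_tag_const i (a : R) : \sum_(s : T | tag s == i) a = a *+ c i.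
Proof. by rewrite (big_tag (fun=> a)) sumr_const card_ord. Qed.

Lemma model_vertex_in sigma : P (model_vertex sigma).
Proof.
apply/PE; split=> [s|i].
  by rewrite /model_vertex p_w_comb lerDl mulr_ge0.
rewrite (eq_bigr (fun s => -1 + (sigma i == Some s)%:R * (c i).+1%:R)) => [|s /eqP si]; last first.
  by rewrite /model_vertex p_w_comb si.
rewrite big_split /= sum_tag_const -mulr_suml.
apply: (@le_trans _ _ (-1 *+ c i + 1 * (c i).+1%:R)); last first.
  by rewrite mul1r mulNrn -natr1 addrA addNr add0r.
rewrite lerD2l ler_wpM2r //; case: (sigma i) => [s|]; last by rewrite big1.
rewrite (@le_trans _ _ (\sum_s' (Some s == Some s')%:R)) //.
  rewrite [leLHS]big_mkcond; apply: ler_sum => s' _; by case: ifP.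
rewrite (bigD1 s) //= eqxx big1 ?addr0 // => s' ss'.
by rewrite (inj_eq Some_inj) eq_sym (negPf ss').
Qed.

Lemma model_vertex_lattice sigma : M (model_vertex sigma).
Proof.
apply/ME => s; rewrite /model_vertex p_w_comb.
by rewrite rpredD ?rpredN ?rpred1 // rpredM ?natr_int.
Qed.

(** A linear function on a simplex is minimal at a vertex. In the shifted coordinates [p s + 1] the
    value at [x] is [D]; if all vertex values exceeded it, a sum of nonnegative terms would equal
    [(1 - q) * D <= 0], so every shifted coordinate would vanish, against [D < 0]. *)
Lemma simplex_minimum i x (alpha : T -> R) : P x -> exists o : option T,
  \sum_(s | tag s == i) (-1 + (o == Some s)%:R * (c i).+1%:R) * alpha s <=
  \sum_(s | tag s == i) (p s x : R) * alpha s.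
Proof.
move=> /PE[xp xq]; apply: contrapT => none.
pose D := \sum_(s | tag s == i) ((p s x : R) + 1) * alpha s.
have DE : \sum_(s | tag s == i) (p s x : R) * alpha s = D - \sum_(s | tag s == i) alpha s.
  rewrite -sumrB; apply: eq_bigr => s _; by rewrite mulrDl mul1r addrK.
have D0 : D < 0.
  rewrite ltNge; apply/negP => D0; apply: none; exists None.
  rewrite DE (eq_bigr (fun s => - alpha s)) => [|s _]; last by rewrite mul0r addr0 mulN1r.
  by rewrite sumrN lerDr.
have Ds s : tag s == i -> D < (c i).+1%:R * alpha s.
  move=> si; rewrite ltNge; apply/negP => Ds; apply: none; exists (Some s).
  rewrite DE; under eq_bigr do rewrite mulrDl mulN1r.
  rewrite big_split sumrN /= addrC lerD2r (bigD1 s) //= eqxx mul1r big1 ?addr0 // => s' /andP[_ s's].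
  by rewrite (inj_eq Some_inj) eq_sym (negPf s's) !mul0r.
have ge0 s : tag s == i -> 0 <= ((p s x : R) + 1) * ((c i).+1%:R * alpha s - D).
  move=> si; rewrite mulr_ge0 //; first by rewrite -lerBlDr sub0r.
  by rewrite subr_ge0 ltW // Ds.
have sum0 : \sum_(s | tag s == i) ((p s x : R) + 1) * ((c i).+1%:R * alpha s - D) = 0.
  apply/le_anti; rewrite sumr_ge0 // andbT.
  under eq_bigr do rewrite mulrBr mulrCA.
  rewrite sumrB -mulr_sumr -/D -mulr_suml big_split /= sum_tag_const.
  have := xq i; rewrite -subr_ge0 -natr1 => q0.
  set q := \sum_(_ | _) _ in q0 *.
  rewrite (_ : _ - _ = (1 - q) * D); last by ring.
  by rewrite mulr_ge0_le0 // ltW.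
move: D0; rewrite /D big1 ?ltxx // => s si.
have /eqP := psumr_eq0P ge0 sum0 si.
rewrite mulf_eq0 => /orP[/eqP ->|]; first by rewrite mul0r.
by rewrite subr_eq0 gt_eqF //; exact: Ds si.
Qed.

(** A separating functional is minimized in each block separately, and the choices combine into one
    [model_vertex]. *)
Lemma model_polytope : lattice_polytope M P.
Proof.
exists (codom model_vertex) => [_ /codomP[sigma ->]|]; first exact: model_vertex_lattice.
apply/seteqP; split=> x.
  move=> Px; apply: contrapT => /separation[u [d [ux ud]]].
  have H i : exists o : option T,
    \sum_(s | tag s == i) (-1 + (o == Some s)%:R * (c i).+1%:R) * (u (w s) : R) <=
    \sum_(s | tag s == i) (p s x : R) * (u (w s) : R) by exact: simplex_minimum.
  pose sigma := [ffun i => sval (cid (H i))].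
  have sigmaP i : \sum_(s | tag s == i) (-1 + (sigma i == Some s)%:R * (c i).+1%:R) * (u (w s) : R) <=
      \sum_(s | tag s == i) (p s x : R) * (u (w s) : R) by rewrite ffunE; case: cid.
  have : d <= (u (model_vertex sigma) : R) by apply/ud/sub_conv_hull => /=; exact: codom_f.
  apply/negP; rewrite -ltNge (le_lt_trans _ ux) // [in leRHS](wp x) !linear_sum.
  rewrite [leLHS](partition_big (fun s : T => tag s) xpredT) //=.
  rewrite [leRHS](partition_big (fun s : T => tag s) xpredT) //=.
  apply: ler_sum => i _; under [leRHS]eq_bigr do rewrite linearZ.
  apply: le_trans (sigmaP i); rewrite le_eqVlt; apply/orP; left; apply/eqP.
  by apply: eq_bigr => s /eqP si; rewrite linearZ /= si.
rewrite model_polytopeE => xv i; apply: conv_hull_ge xv => _ /codomP[sigma ->].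
by have := model_vertex_in sigma; rewrite model_polytopeE; apply.
Qed.

(** The argument of [bipolar] on the dual side: by [dual_eval] the separating functional is a point,
    and a positive multiple of it lies in [P]. *)
Lemma model_dualE : dual_polytope P = conv_hull (range (with_origin block_normal)).
Proof.
have codomE : [set` codom (with_origin block_normal)] = range (with_origin block_normal).
  apply/seteqP; split=> [_ /codomP[j ->]|_ [j _ <-]]; [by exists j|exact: codom_f].
apply/seteqP; split=> z; last first.
  move=> /conv_hull_range[a [a0 a1 ->]] x; rewrite model_polytopeE => xP.
  rewrite sum_lfunE -[-1]mul1r -{1}a1 mulr_suml; apply: ler_sum => o _.
  rewrite scale_lfunE; apply: ler_wpM2l => //; case: o => [i|] /=; first exact: xP.
  by rewrite lfunE /= lerN10.
rewrite -codomE => zP; apply: contrapT => /separation[U [d [Uz Ud]]].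
have [x Ux] := dual_eval U; rewrite Ux in Uz.
have {}Ud h : h \in codom (with_origin block_normal) -> d <= (h x : R).
  by move=> hc; rewrite -Ux; apply/Ud/sub_conv_hull.
have d0 : d <= 0 by have := Ud 0; rewrite lfunE; apply; exact: (codom_f _ None).
pose k := - (d + (z x : R)) / 2.
have k0 : 0 < k by rewrite /k; lra.
have : P (k^-1 *: x).
  rewrite model_polytopeE => i; rewrite /= linearZ /= /GRing.scale /= mulrC ler_pdivlMr // mulN1r.
  by have := Ud _ (codom_f _ (Some i)); rewrite /= /k; lra.
move/zP; rewrite linearZ /= /GRing.scale /= mulrC ler_pdivlMr // mulN1r /k; lra.
Qed.

Lemma dual_latticeP (h : 'Hom(W, R^o)) :
  dual_lattice M h <-> forall s, (h (w s) : R) \is a Num.int.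
Proof.
split=> [hM s|hw x /ME xint].
  by apply: hM; apply/ME => s'; rewrite pw; case: eqP.
rewrite (wp x) linear_sum rpred_sum // => s _; rewrite linearZ /GRing.scale /=.
exact: rpredM.
Qed.

Lemma model_dual_polytope : lattice_polytope (dual_lattice M) (dual_polytope P).
Proof.
exists (codom (with_origin block_normal)); last first.
  rewrite model_dualE; congr conv_hull; apply/seteqP.
  by split=> [_ [j _ <-]|_ /codomP[j ->]]; [exact: codom_f|exists j].
move=> _ /codomP[[[s|k]|] ->]; apply/dual_latticeP => s'.
- by rewrite pw; case: eqP.
- rewrite /with_origin block_normalE rpredN rpred_sum // => s _; by rewrite pw natr_int.
- by rewrite lfunE rpred0.
Qed.

Lemma model_reflexive : reflexive_polytope M P.
Proof.
split; [exact: model_lattice|exact: model_interior|exact: model_polytope|exact: model_dual_polytope].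
Qed.

Lemma block_normal_w i s :
  (block_normal i (w s) : R) = (i == inl s)%:R - (i == inr (tag s))%:R.
Proof.
case: i => [s'|k]; first by rewrite /= pw subr0.
rewrite block_normalE sub0r -[inr k == _]/(k == tag s); congr (- _).
rewrite big_mkcond (bigD1 s) //= big1 => [|s' s's]; rewrite pw.
  by rewrite eqxx addr0 eq_sym; case: ifP.
by rewrite (negPf s's) if_same.
Qed.

Lemma block_normal_coord (a : T + 'I_t -> R) (S : {set T + 'I_t}) s :
  ((\sum_(i in S) a i *: block_normal i) (w s) : R) =
  (if inl s \in S then a (inl s) else 0) - (if inr (tag s) \in S then a (inr (tag s)) else 0).
Proof.
rewrite sum_lfunE; under eq_bigr do rewrite scale_lfunE block_normal_w.
rewrite big_mkcond (bigD1 (inl s)) //= (bigD1 (inr (tag s))) //= big1.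
  by rewrite /GRing.scale /= !eqxx subr0 sub0r mulr1 mulrN1 addr0; case: (inr _ \in S); rewrite ?oppr0.
by move=> i /andP[/negPf -> /negPf ->]; rewrite subrr scaler0 if_same.
Qed.

(** The vanishing block sums are the only relations between the normals: values at the [inl s]
    prescribe a point of [W], and the zero sum then dictates the value at [inr k]. *)
Lemma normal_fanE : normal_fan P =
  [set C | exists2 S : {set T + 'I_t},
     misses_every_block (fun i => match i with inl s => tag s | inr k => k end) S &
     C = pos_hull (block_normal @` [set` S])].
Proof.
rewrite /normal_fan model_dualE; apply: face_fan_blocks => [k|k|v vsum].
- by exists (inr k).
- by rewrite big_sumType /= (big_pred1 k) ?addrN.
have evl : linear (fun h : 'Hom(W, R^o) => h (\sum_s v (inl s) *: w s)).
  by move=> a h h'; rewrite add_lfunE scale_lfunE.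
exists (linfun (fun h : 'Hom(W, R^o) => h (\sum_s v (inl s) *: w s))) => -[s|k]; rewrite linfunE //.
  by rewrite /= (p_w_comb (fun s => v (inl s))).
rewrite block_normalE; under eq_bigr do rewrite (p_w_comb (fun s => v (inl s))).
have := vsum k; rewrite big_sumType /= (big_pred1 k) //.
by move/eqP; rewrite addr_eq0 => /eqP ->; rewrite opprK.
Qed.

Definition dual_coordinates (h : 'Hom(W, R^o)) : 'rV[R]_(\sum_i c i) :=
  \row_k (h (w (tagnat.sig k)) : R).

Lemma dual_coordinates_linear : linear dual_coordinates.
Proof. by move=> a g h; apply/rowP => k; rewrite !mxE add_lfunE scale_lfunE. Qed.

Lemma dual_coordinatesE h s : dual_coordinates h 0 (tagnat.rank s) = h (w s).
Proof. by rewrite mxE tagnat.rankK. Qed.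

(** A normal only affects the coordinates of its own block, so the cone splits; in block [i] the
    normals [inl] become the unit vectors and [inr i] the vertex [None]. *)
Lemma dual_coordinates_cone (S : {set T + 'I_t}) (S' : forall i, {set option 'I_(c i)}) :
  (forall s, (inl s \in S) = (Some (tagged s) \in S' (tag s))) ->
  (forall k, (inr k \in S) = (None \in S' k)) ->
  dual_coordinates @` pos_hull (block_normal @` [set` S]) =
  direct_sum_rV (fun i => pos_hull (@simplex_vertex R (c i) @` [set` S' i])).
Proof.
move=> Sl Sr; apply/seteqP; split=> [_ [h /pos_hull_range[a a0 ->] <-] i|r rS].
  apply/simplex_cone.
  exists (fun x : option 'I_(c i) => if x is Some j then a (inl (Tagged (fun k => 'I_(c k)) j)) else a (inr i)).
    by case.
  by move=> j; rewrite mxE dual_coordinatesE block_normal_coord Sl Sr.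
have H i : exists a : option 'I_(c i) -> R, (forall x, 0 <= a x) /\
    forall j, submxrow r i 0 j =
      (if Some j \in S' i then a (Some j) else 0) - (if None \in S' i then a None else 0).
  by have /simplex_cone[a a0 ra] := rS i; exists a.
pose a i := sval (cid (H i)).
have aP i : (forall x, 0 <= a i x) /\
    forall j, submxrow r i 0 j =
      (if Some j \in S' i then a i (Some j) else 0) - (if None \in S' i then a i None else 0).
  by rewrite /a; case: cid.
pose b (i : T + 'I_t) := match i with inl s => a (tag s) (Some (tagged s)) | inr k => a k None end.
exists (\sum_(i in S) b i *: block_normal i).
  by apply/pos_hull_range; exists b => // -[s|k]; [have [+ _] := aP (tag s)|have [+ _] := aP k]; apply.
apply/rowP => k; rewrite -(tagnat.sigK k) dual_coordinatesE block_normal_coord Sl Sr /=.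
have := proj2 (aP (tag (tagnat.sig k))) (tagged (tagnat.sig k)).
by rewrite mxE /tagnat.Rank => <-; congr (r 0 _); case: (tagnat.sig k).
Qed.

Lemma model_fan :
  fan_iso (dual_lattice M) (normal_fan P)
    (@int_lattice R (\sum_i c i)) (@projective_product_fan R t c).
Proof.
exists (linfun dual_coordinates).
have fE := linfunE dual_coordinates_linear.
split; first split=> [h hM k|h h' _ _|r rint].
- rewrite fE -(tagnat.sigK k) dual_coordinatesE.
  exact: (proj1 (dual_latticeP h) hM).
- rewrite !fE => hh'; apply/lfunP => x; rewrite (wp x) !linear_sum.
  by apply: eq_bigr => s _; rewrite !linearZ /= -!dual_coordinatesE hh'.
- exists (\sum_s r 0 (tagnat.rank s) *: p s).
    apply/dual_latticeP => s; rewrite sum_lfunE rpred_sum // => s' _.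
    by rewrite scale_lfunE rpredM // pw natr_int.
  rewrite fE; apply/rowP => k; rewrite -(tagnat.sigK k) dual_coordinatesE.
  rewrite sum_lfunE (bigD1 (tagnat.sig k)) //= [X in _ + X]big1 => [|s sk]; rewrite scale_lfunE pw /GRing.scale /=.
    by rewrite eqxx mulr1 addr0.
  by rewrite (negPf sk) mulr0.
have imE A : linfun dual_coordinates @` A = dual_coordinates @` A.
  by apply/seteqP; split=> _ [h Ah <-]; exists h.
rewrite normal_fanE; apply/seteqP; split=> [_ [_ [S Smiss ->] <-]|_ [tau tauP ->]].
  pose S' i : {set option 'I_(c i)} :=
    [set x | if x is Some j then inl (Tagged (fun k => 'I_(c k)) j) \in S else inr i \in S]%SET.
  exists (fun i => pos_hull (@simplex_vertex R (c i) @` [set` S' i])).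
    move=> i; rewrite projective_fanE; exists (S' i) => //.
    have [[[k j]|k] /= ki iS] := Smiss i.
      by subst k; exists (Some j); rewrite inE.
    by exists None; rewrite inE -ki.
  by rewrite imE; apply: dual_coordinates_cone => [[k j]|k]; rewrite inE.
have H i : exists S : {set option 'I_(c i)},
    (exists x, x \notin S) /\ tau i = pos_hull (@simplex_vertex R (c i) @` [set` S]).
  by have := tauP i; rewrite projective_fanE => -[S xS ->]; exists S.
pose S' i := sval (cid (H i)).
have S'P i : (exists x, x \notin S' i) /\ tau i = pos_hull (@simplex_vertex R (c i) @` [set` S' i]).
  by rewrite /S'; case: cid.
pose S : {set T + 'I_t} :=
  [set i | match i with inl s => Some (tagged s) \in S' (tag s) | inr k => None \in S' k end]%SET.
exists (pos_hull (block_normal @` [set` S])).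
  exists S => // i; have [[[j|] jS] _] := S'P i.
    by exists (inl (Tagged (fun k => 'I_(c k)) j)); rewrite ?inE.
  by exists (inr i); rewrite ?inE.
rewrite imE (dual_coordinates_cone (S' := S')) => [|s|k]; rewrite ?inE //.
congr direct_sum_rV; apply: functional_extensionality_dep => i.
by case: (S'P i).
Qed.

End ProductModel.

(** * A basis of the span of the semisimple roots *)

Section SemisimpleSpan.
Variables (R : realType) (V : vectType R) (M P : set V) (Y : seq 'Hom(V, R^o)).
Hypothesis lM : is_lattice M.
Hypothesis P0 : near_vect 0 P.
Hypothesis PE : P = [set x | forall y, y \in Y -> -1 <= (y x : R)].
Hypothesis YE : dual_polytope P = conv_hull [set` Y].
Hypothesis Yint : forall y, y \in Y -> dual_lattice M y.
Hypothesis Y_sep : forall x x', (forall y, y \in Y -> (y x : R) = y x') -> x = x'.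

Let U := lin (semisimple_roots M P).

(** The value pattern of a semisimple root with normals [y1] and [y2]. Asking only for membership in
    [M] and [U] makes the notion stable under sums along a chain, whether or not the sum is again a
    root. *)
Let difference (y1 y2 : 'Hom(V, R^o)) (m : V) := [/\ M m, m \in U &
  forall y : 'Hom(V, R^o), y \in Y -> (y m : R) = (y == y2)%:R - (y == y1)%:R].

Lemma latticeD x x' : M x -> M x' -> M (x + x').
Proof.
move=> Mx Mx'; have := @lattice_sum _ _ _ bool (fun=> 1) (fun i => if i then x else x') lM.
rewrite big_bool !scale1r; apply => [i|[]//]; exact: rpred1.
Qed.

Lemma latticeN x : M x -> M (- x).
Proof.
move=> Mx; have := @lattice_sum _ _ _ unit (fun=> -1) (fun=> x) lM.
rewrite big_const card_unit /= addr0 scaleN1r; apply => // _; by rewrite rpredN rpred1.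
Qed.

Lemma lattice0 : M 0.
Proof.
have := @lattice_sum _ _ _ void (fun=> 0) (fun=> 0) lM.
by rewrite big1 => [|[]]; apply => -[].
Qed.

Lemma difference_refl y : difference y y 0.
Proof. split; [exact: lattice0|exact: mem0v|by move=> z _; rewrite linear0 subrr]. Qed.

Lemma difference_sym y1 y2 m : difference y1 y2 m -> difference y2 y1 (- m).
Proof.
move=> [Mm mU mv]; split; [exact: latticeN|by rewrite memvN|].
by move=> y yY; rewrite linearN /= mv // opprB.
Qed.

Lemma difference_trans y2 y1 y3 m m' :
  difference y1 y2 m -> difference y2 y3 m' -> difference y1 y3 (m + m').
Proof.
move=> [Mm mU mv] [Mm' mU' mv']; split; [exact: latticeD|exact: memvD|].
by move=> y yY; rewrite linearD /= mv // mv' // addrC addrA subrK.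
Qed.

(* Call two elements of [Y] related if they are joined by a [difference]; the  *)
(* vectors [b s] are the differences of a representative of each class and the *)
(* other members of that class.                                                *)
Lemma semisimple_span_basis : exists (t : nat) (c : 'I_t -> nat)
    (b : {k : 'I_t & 'I_(c k)} -> V) (p q : {k : 'I_t & 'I_(c k)} -> 'Hom(V, R^o)),
  [/\ [/\ forall s, M (b s), forall s, p s \in Y & forall s, q s \in Y],
      forall (y : 'Hom(V, R^o)) s, y \in Y ->
        (y (b s) : R) = (y == q s)%:R - (y == p s)%:R,
      [/\ injective p, forall s s', p s != q s' &
          forall s s', (q s == q s') = (tag s == tag s')] &
      lin (range b) = U].
Proof.
pose I := seq_sub Y.
pose e (i j : I) := `[< exists m, difference (val i) (val j) m >].
have e_refl i : e i i by apply/asboolP; exists 0; exact: difference_refl.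
have e_sym i j : e i j -> e j i.
  by move=> /asboolP[m d]; apply/asboolP; exists (- m); exact: difference_sym.
have e_trans i j k : e i j -> e j k -> e i k.
  move=> /asboolP[m d] /asboolP[m' d']; apply/asboolP.
  by exists (m + m'); exact: difference_trans d d'.
pose rep i := choose (e i) i.
have e_rep i : e i (rep i) by exact: chooseP.
have rep_eq i j : e i j -> rep i = rep j.
  move=> ij; rewrite /rep; have -> : choose (e j) j = choose (e i) j.
    by apply: eq_choose => k; apply/idP/idP; apply: e_trans => //; exact: e_sym.
  exact: choose_id.
have repK i : rep (rep i) = rep i by apply/esym/rep_eq.
(* Blocks are indexed by all of [Y]. The block of an element that is not a representative is empty
   and contributes a factor of dimension 0. *)
pose members (k : 'I_#|{: I}|) := [set i | (rep i == enum_val k) && (i != enum_val k)]%SET.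
pose c k := #|members k|.
pose T := {k : 'I_#|{: I}| & 'I_(c k)}.
pose pi (s : T) : I := enum_val (tagged s : 'I_#|members (tag s)|).
pose qi (s : T) : I := enum_val (tag s).
have piP s : rep (pi s) = qi s /\ pi s != qi s.
  have := enum_valP (tagged s : 'I_#|members (tag s)|); rewrite inE => /andP[/eqP ? ?].
  by split.
have B s : exists m, difference (val (pi s)) (val (qi s)) m.
  by have [<- _] := piP s; apply/asboolP; exact: e_rep.
pose b s := sval (cid (B s)).
have bP s : difference (val (pi s)) (val (qi s)) (b s) by rewrite /b; case: cid.
have pi_inj : injective pi.
  move=> s s' E; have qE : tag s = tag s'.
    by apply: enum_val_inj; rewrite -[LHS]/(qi s) -(proj1 (piP s)) E (proj1 (piP s')).
  case: s s' qE E => k j [k' j'] /= kk'; subst k' => E.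
  by congr (Tagged _ _); exact: enum_val_inj E.
exists #|{: I}|, c, b, (val \o pi), (val \o qi); split.
- by split=> s; [case: (bP s)|exact: valP|exact: valP].
- by move=> y s; case: (bP s) => _ _; apply.
- split=> [s s' /val_inj/pi_inj//|s s'|s s'].
    apply/eqP => /val_inj E; have [_ /eqP] := piP s; apply.
    by rewrite -(proj1 (piP s)) E -(proj1 (piP s')) repK.
  by rewrite /= (inj_eq val_inj) (inj_eq enum_val_inj).
apply/eqP; rewrite eqEsubv; apply/andP; split.
  by apply: lin_sub => _ [s _ <-]; case: (bP s).
apply: lin_sub => m mS.
(* Every element of [Y] is joined to its representative within the span of [b]. A semisimple root
   joins two elements with the same representative, so it is the difference of two such vectors. *)
have rep_vect i : exists2 v, v \in lin (range b) &
    forall y : 'Hom(V, R^o), y \in Y -> (y v : R) = (y == val (rep i))%:R - (y == val i)%:R.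
  have [ii|ni] := eqVneq i (rep i).
    by exists 0 => [|y _]; rewrite ?mem0v // linear0 -ii subrr.
  have im : i \in members (enum_rank (rep i)) by rewrite inE enum_rankK eqxx.
  pose s : T := Tagged (fun k => 'I_(c k)) (enum_rank_in im i : 'I_(c (enum_rank (rep i)))).
  have pis : pi s = i by rewrite /pi /= enum_rankK_in.
  exists (b s); first by apply: mem_lin; exists s.
  by move=> y yY; have [_ _ ->] := bP s; rewrite // -(proj1 (piP s)) pis.
have [e1Y e2Y _ mv] := semisimple_root_values P0 PE YE Yint mS.
pose i1 : I := SeqSub e1Y; pose i2 : I := SeqSub e2Y.
have i12 : rep i1 = rep i2.
  apply: rep_eq; apply/asboolP; exists m; split=> //.
    by case: mS => -[].
  exact: mem_lin.
have [v1 v1b v1v] := rep_vect i1; have [v2 v2b v2v] := rep_vect i2.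
have -> : m = v1 - v2; last by rewrite memvB.
apply: Y_sep => y yY; rewrite linearB /= mv // v1v // v2v // i12 /=.
by rewrite opprB [RHS]addrC addrA subrK.
Qed.

End SemisimpleSpan.

(** * Restriction of the polytope to that span *)

Section Restriction.
Variables (R : realType) (V : vectType R) (M P : set V) (Y : seq 'Hom(V, R^o)).
Hypothesis lM : is_lattice M.
Hypothesis P0 : near_vect 0 P.
Hypothesis PE : P = [set x | forall y, y \in Y -> -1 <= (y x : R)].
Hypothesis YE : dual_polytope P = conv_hull [set` Y].
Hypothesis Yint : forall y, y \in Y -> dual_lattice M y.
Hypothesis Y_sep : forall x x', (forall y, y \in Y -> (y x : R) = y x') -> x = x'.

Lemma semisimple_restriction (U := lin (semisimple_roots M P)) :
  reflexive_polytope (restrict_to U M) (restrict_to U P) /\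
  product_of_projective_spaces (restrict_to U M) (restrict_to U P).
Proof.
have [t [c [b [p [q [[bM pY qY] b_val [p_inj pq q_tag] UE]]]]]] :=
  semisimple_span_basis lM P0 PE YE Yint Y_sep.
rewrite -/U in UE.
have bU s : b s \in U by rewrite -UE mem_lin //; exists s.
have valU (x : subvs_of U) : vsval x \in lin (range b) by rewrite UE subvsP.
(* The sign makes [w] and the restricted [p s] dual bases, as the product model assumes. *)
pose w s : subvs_of U := vsproj U (- b s).
pose pU s : 'Hom(subvs_of U, R^o) := (p s \o linfun (vsval : subvs_of U -> V))%VF.
have pUE s x : (pU s x : R) = p s (vsval x) by rewrite comp_lfunE lfunE.
have pw s s' : (pU s (w s') : R) = (s == s')%:R.
  by rewrite pUE vsprojK ?memvN // linearN /= (pb pY b_val p_inj pq) opprK.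
have wp x : x = \sum_s (pU s x : R) *: w s.
  apply: val_inj; rewrite /= [LHS](comb_p pY b_val p_inj pq (valU x)) linear_sum.
  by apply: eq_bigr => s _; rewrite linearZ /= vsprojK ?memvN // pUE scaleNr scalerN.
have ME x : restrict_to U M x <-> forall s, (pU s x : R) \is a Num.int.
  rewrite /restrict_to /= (lattice_coordinates lM Yint bM pY b_val p_inj pq (valU x)).
  by split=> H s; have := H s; rewrite pUE.
have PxE x : restrict_to U P x <-> (forall s, -1 <= (pU s x : R)) /\
    (forall i, \sum_(s | tag s == i) (pU s x : R) <= 1).
  rewrite /restrict_to /= (polytope_coordinates PE pY qY b_val p_inj pq q_tag (valU x)).
  by split=> -[H1 H2]; split=> [s|i]; have := (H1, H2);
    [move=> [/(_ s)]|move=> [_ /(_ i)]|move=> [/(_ s)]|move=> [_ /(_ i)]];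
    rewrite ?pUE //; under eq_bigr do rewrite pUE.
split; first exact: model_reflexive pw wp ME PxE.
by exists t, c; exact: model_fan pw wp ME PxE.
Qed.

End Restriction.

Theorem theorem3p9 (R : realType) (V : vectType R) (M P : set V)
  (P_reflexive : reflexive_polytope M P) :
  (forall (A B : set V) (t : nat) (C : 'I_t -> set V) (c : 'I_t -> nat),
     A `<=` root_set M P ->
     B `<=` semisimple_roots M P ->
     root_basis M P A B ->
     set_bij [set: 'I_t] (equiv_classes M P B) C ->
     (forall i, (C i #= `I_(c i))%card) ->
     lattice_polytope_iso
       (M `&` [set` lin A]) (P `&` [set` lin A])
       (direct_sum (fun i => M `&` [set` lin (C i)]))
       (direct_sum (fun i => P `&` [set` lin (C i)]))
     /\
     lattice_polytope_iso
       (direct_sum (fun i => M `&` [set` lin (C i)]))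
       (direct_sum (fun i => P `&` [set` lin (C i)]))
       (@int_lattice R (\sum_i c i))
       (direct_sum_rV (fun i => @dual_simplex R (c i))))
  /\
  (let U := lin (semisimple_roots M P) in
   reflexive_polytope (restrict_to U M) (restrict_to U P) /\
   product_of_projective_spaces (restrict_to U M) (restrict_to U P)).
Proof.
have [lM P0 [s _ Ps] [Y Yint YE]] := P_reflexive.
have PE := bipolar Ps YE (near_vect_in P0).
split=> [A B t C c _|].
  exact: (root_basis_iso lM P0 PE YE).
exact: (semisimple_restriction lM P0 PE YE Yint (dual_vertices_separate Ps PE)).
Qed.
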